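(* Let $k, q$ be positive integers and let $H$ be a $k$-uniform hypergraph on $n$ vertices with skeletal degeneracy $d_1(H)=d$. Then the $q$-color Ramsey number of $H$ satisfies $r(H;q)\leq O_{k,d,q}(n)$; that is, there is a constant $C$ depending only on $k,d,q$ such that $r(H;q) \le Cn$.
   Context: The $q$-color Ramsey number $r(H;q)$ is the minimum positive integer $N$ such that every coloring of the edges of the complete $k$-uniform hypergraph $K_N^{(k)}$ with $q$ colors contains a monochromatic copy of $H$. The $1$-skeleton $H^{(1)}$ of a $k$-uniform hypergraph $H$ is the graph on $V(H)$ in which two vertices are adjacent iff they lie in a common edge of $H$; the skeletal degeneracy $d_1(H)$ is the degeneracy of $H^{(1)}$, i.e. the least $d$ such that every subgraph of $H^{(1)}$ has minimum degree at most $d$. *)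

(* Defs.v *)
From mathcomp Require Import all_boot.

Set Implicit Arguments.
Unset Strict Implicit.
Unset Printing Implicit Defensive.

(* The vertex set is the whole type [V]; isolated vertices are allowed. *)
Record hypergraph (k : nat) (V : finType) := Hypergraph {
  edges : {set {set V}};
  edges_uniform : forall e, e \in edges -> #|e| = k
}.

(* Simple graphs on [V] are given by their edge sets: sets of pairs [set u; v]
   with u != v. *)
Definition skeleton (k : nat) (V : finType) (H : hypergraph k V) :
    {set {set V}} :=
  [set [set u; v] | u in V, v in V
    & (u != v) && [exists h in edges H, (u \in h) && (v \in h)]].

Definition degree (V : finType) (F : {set {set V}}) (v : V) : nat :=
  #|[set e in F | v \in e]|.

(* A subgraph is a vertex set S together with a set F of edges lying inside S;
   S is required to be nonempty, as minimum degree makes no sense otherwise. *)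
Definition subgraph (V : finType) (S : {set V}) (F G : {set {set V}}) : bool :=
  [&& S != set0, F \subset G & F \subset powerset S].

Definition degenerate (V : finType) (G : {set {set V}}) (d : nat) : bool :=
  [forall S : {set V}, forall F : {set {set V}},
    subgraph S F G ==> [exists v in S, degree F v <= d]].

Lemma ex_degenerate (V : finType) (G : {set {set V}}) :
  exists d, degenerate G d.
Proof.
exists #|G|; apply/forallP => S; apply/forallP => F; apply/implyP.
case/and3P => /set0Pn[v Sv] sFG _; apply/existsP; exists v; rewrite Sv /=.
apply: leq_trans (subset_leq_card sFG); apply: subset_leq_card.
by apply/subsetP => e; rewrite inE => /andP[].
Qed.

Definition degeneracy (V : finType) (G : {set {set V}}) : nat :=
  ex_minn (ex_degenerate G).

Definition skeletal_degeneracy (k : nat) (V : finType) (H : hypergraph k V) :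
    nat :=
  degeneracy (skeleton H).

Definition complete_edge (k N : nat) : Type := {e : {set 'I_N} | #|e| == k}.

(* As [H] is k-uniform and [f] is injective, [f @: h] is the underlying set of
   exactly one [e : complete_edge k N]. *)
Definition has_monochromatic_copy (k q N : nat) (V : finType)
    (H : hypergraph k V) (c : complete_edge k N -> 'I_q) : Prop :=
  exists (f : V -> 'I_N) (i : 'I_q), injective f /\
    forall (h : {set V}) (e : complete_edge k N),
      h \in edges H -> val e = f @: h -> c e = i.

Definition ramsey_property (k q : nat) (V : finType) (H : hypergraph k V)
    (N : nat) : Prop :=
  forall c : complete_edge k N -> 'I_q, has_monochromatic_copy H c.

(* r(H; q) = r. This is a relation, not a function of H and q, since the
   existence of r(H; q) is itself a theorem (Ramsey). *)
Definition is_ramsey_number (k q : nat) (V : finType) (H : hypergraph k V)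
    (r : nat) : Prop :=
  [/\ 0 < r, ramsey_property q H r
    & forall N, 0 < N -> ramsey_property q H N -> r <= N].

(* Main.v *)
(* Dependent random choice combined with a random greedy embedding, after Lee.

   Iterated removal of the vertices of small degree in the 1-skeleton orders the
   vertices by levels so that every vertex x has at most D = O(d) earlier
   neighbours and the sum of 2^(level x) is O(n).  Sample a monochromatic clique
   T, split into one block per colour class ("type") of the 1-skeleton, and label
   the N target vertices independently, a label of level l having probability of
   order 2^-l.  The image of x is sought among the vertices with its label which,
   together with the images of its earlier neighbours and with blocks of T of
   other types, only form edges of the colour of T.  The block of T of the type of
   x lies in that set of candidates (labels apart), so the set is rarely small: inverse moments
   of its relative size are bounded on average over uniform images.

   Layers are embedded one after the other, inside a layer in increasing order of
   the number of candidates, and uniformly among the candidates still free.  If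
   the inverse numbers of candidates over a layer sum to at most 1/2, half of the
   candidates are always free; so only these sums have to be controlled, in
   expectation, and no union bound over the n vertices is needed.  The process is
   biased with respect to uniform images by the inverse relative sizes of the
   candidate sets, whose moments are bounded by induction along the order. *)
Require Import Defs.
From Stdlib Require Import Classical_Prop.
From mathcomp Require Import all_boot all_order all_algebra.
From mathcomp Require Import ring lra zify.

Set Implicit Arguments.
Unset Strict Implicit.
Unset Printing Implicit Defensive.

Import Order.TTheory GRing.Theory Num.Theory.
Local Open Scope ring_scope.

(** * Product measures *)

Definition dep_on (I : finType) (L T : Type) (W : {set I})
    (f : {ffun I -> L} -> T) : Prop :=
  forall u v : {ffun I -> L}, {in W, u =1 v} -> f u = f v.

Definition glue (I : finType) (L : Type) (W : {set I}) (u v : {ffun I -> L}) :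
    {ffun I -> L} :=
  [ffun i => if i \in W then v i else u i].

Definition upd (I : finType) (L : Type) (u : {ffun I -> L}) (x : I) (l : L) :
    {ffun I -> L} :=
  [ffun i => if i == x then l else u i].

Lemma dep_on_sub (I : finType) (L T : Type) (W W' : {set I})
    (f : {ffun I -> L} -> T) :
  W \subset W' -> dep_on W f -> dep_on W' f.
Proof. by move=> sW df u v e; apply: df => i iW; apply/e/(subsetP sW). Qed.

Section ProductMeasure.
Variables (F : realFieldType) (I L : finType).
Implicit Types (p : L -> F) (f g : {ffun I -> L} -> F) (W : {set I}).

(** The expectation of [f] when the coordinates are independent with common law [p]. *)
Definition Ex p f : F := \sum_(u : {ffun I -> L}) (\prod_i p (u i)) * f u.

Definition distr p := (forall l, 0 <= p l) /\ \sum_l p l = 1.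

Lemma eq_Ex p f g : f =1 g -> Ex p f = Ex p g.
Proof. by move=> e; apply: eq_bigr => u _; rewrite e. Qed.

Lemma Ex_le p f g : distr p -> (forall u, f u <= g u) -> Ex p f <= Ex p g.
Proof.
move=> [p0 _] le; apply: ler_sum => u _; apply: ler_wpM2l => //.
by apply: prodr_ge0.
Qed.

Lemma Ex_ge0 p f : distr p -> (forall u, 0 <= f u) -> 0 <= Ex p f.
Proof.
by move=> [p0 _] f0; apply: sumr_ge0 => u _; rewrite mulr_ge0 ?prodr_ge0.
Qed.

Lemma ExZ p c f : Ex p (fun u => c * f u) = c * Ex p f.
Proof. by rewrite /Ex mulr_sumr; apply: eq_bigr => u _; ring. Qed.

Lemma ExZr p c f : Ex p (fun u => f u * c) = Ex p f * c.
Proof. by rewrite mulrC -ExZ; apply: eq_Ex => u; ring. Qed.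

Lemma ExD p f g : Ex p (fun u => f u + g u) = Ex p f + Ex p g.
Proof. by rewrite /Ex -big_split; apply: eq_bigr => u _; rewrite mulrDr. Qed.

Lemma Ex_sum p (J : finType) (P : pred J) (f : J -> {ffun I -> L} -> F) :
  Ex p (fun u => \sum_(j | P j) f j u) = \sum_(j | P j) Ex p (f j).
Proof. by rewrite exchange_big /=; apply: eq_bigr => u _; rewrite mulr_sumr. Qed.

Lemma Ex_prodT p (h : I -> L -> F) :
  Ex p (fun u => \prod_i h i (u i)) = \prod_i \sum_l p l * h i l.
Proof.
rewrite (bigA_distr_bigA (fun i l => p l * h i l)); apply: eq_bigr => u _.
by rewrite -big_split.
Qed.

Lemma Ex_prod p W (h : I -> L -> F) : distr p ->
  Ex p (fun u => \prod_(i in W) h i (u i)) = \prod_(i in W) \sum_l p l * h i l.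
Proof.
move=> [_ p1]; transitivity
  (Ex p (fun u => \prod_i (if i \in W then h i (u i) else 1))).
  by apply: eq_Ex => u; rewrite big_mkcond.
rewrite (Ex_prodT p (fun i l => if i \in W then h i l else 1)) [RHS]big_mkcond.
apply: eq_bigr => i _; case: (i \in W) => //.
by rewrite -[RHS]p1; apply: eq_bigr => l _; rewrite mulr1.
Qed.

Lemma Ex_cst p c : distr p -> Ex p (fun=> c) = c.
Proof.
move=> dp; have := Ex_prod set0 (fun _ _ => 0) dp.
rewrite (@eq_Ex p _ (fun=> 1)) => [e|u]; last by rewrite big_set0.
rewrite (@eq_Ex p _ (fun=> c * 1)) => [|u]; last by rewrite mulr1.
by rewrite ExZ e big_set0 mulr1.
Qed.

(** Exchanging the [W]-coordinates of two independent samples is an involution that preserves the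
    product weight, so resampling [W] preserves expectations. This takes the place of conditioning
    on the other coordinates. *)
Lemma Ex_glue p W f : distr p ->
  Ex p (fun u => Ex p (fun v => f (glue W u v))) = Ex p f.
Proof.
move=> dp; pose sw (uv : {ffun I -> L} * {ffun I -> L}) :=
  (glue W uv.1 uv.2, glue W uv.2 uv.1).
have swK : involutive sw.
  have mK u v : glue W (glue W u v) (glue W v u) = u.
    by apply/ffunP=> i; rewrite !ffunE; case: (i \in W).
  by case=> u v; rewrite /sw /= !mK.
transitivity (\sum_(uv : {ffun I -> L} * {ffun I -> L}) (\prod_i p (uv.1 i)) * (\prod_i p (uv.2 i)) *
               f (sw uv).1).
  rewrite -(pair_bigA _ (fun u v : {ffun I -> L} => (\prod_i p (u i)) * (\prod_i p (v i)) *
               f (sw (u, v)).1)) /=.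
  by apply: eq_bigr => u _; rewrite mulr_sumr; apply: eq_bigr => v _; ring.
transitivity (\sum_(uv : {ffun I -> L} * {ffun I -> L}) (\prod_i p (uv.1 i)) * (\prod_i p (uv.2 i)) * f uv.1).
  rewrite [RHS](reindex_inj (inv_inj swK)) /=; apply: eq_bigr => -[u v] _ /=.
  congr (_ * _); rewrite -!big_split; apply: eq_bigr => i _ /=; rewrite !ffunE.
  by case: ifP => _ //; rewrite mulrC.
rewrite -(pair_bigA _ (fun u v : {ffun I -> L} => (\prod_i p (u i)) * (\prod_i p (v i)) * f u)).
apply: eq_bigr => u _ /=; rewrite -mulr_suml -mulr_sumr.
suff -> : \sum_(v : {ffun I -> L}) \prod_i p (v i) = 1 by rewrite mulr1.
rewrite -[RHS](Ex_cst 1 dp); apply: eq_bigr => v _; by rewrite mulr1.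
Qed.

Lemma Ex_indep p W f g : distr p -> dep_on W f -> dep_on (~: W) g ->
  Ex p (fun u => f u * g u) = Ex p f * Ex p g.
Proof.
move=> dp df dg; rewrite -(Ex_glue W _ dp).
rewrite (@eq_Ex p _ (fun u => Ex p f * g u)) ?ExZ // => u.
rewrite -ExZr; apply: eq_Ex => v; congr (_ * _).
  by apply: df => i iW; rewrite ffunE iW.
by apply: dg => i; rewrite inE ffunE => /negPf ->.
Qed.

Lemma Ex_coord p i (h : L -> F) : distr p ->
  Ex p (fun u => h (u i)) = \sum_l p l * h l.
Proof.
move=> dp; have := Ex_prod [set i] (fun _ => h) dp; rewrite big_set1 => <-.
by apply: eq_Ex => u; rewrite big_set1.
Qed.

End ProductMeasure.

(** * Weighted sequences and distinct representatives *)

Section WeightedSeq.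
Variable F : realFieldType.

Definition Ed (T : Type) (d : seq (F * T)) (f : T -> F) : F :=
  \sum_(p <- d) p.1 * f p.2.

Definition bind (T U : Type) (d : seq (F * T)) (k : T -> seq (F * U)) :=
  [seq (p.1 * q.1, q.2) | p <- d, q <- k p.2].

Definition average (A : finType) (T : Type) (S : {set A}) (h : A -> T) :
    seq (F * T) :=
  [seq (#|S|%:R^-1, h v) | v <- enum S].

Lemma Ed_bind (T U : Type) (d : seq (F * T)) (k : T -> seq (F * U)) f :
  Ed (bind d k) f = Ed d (fun t => Ed (k t) f).
Proof.
rewrite /Ed /bind big_allpairs_dep; apply: eq_bigr => p _.
by rewrite mulr_sumr; apply: eq_bigr => q _; rewrite mulrA.
Qed.

Lemma Ed_average (A : finType) (T : Type) (S : {set A}) (h : A -> T) f :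
  Ed (average S h) f = #|S|%:R^-1 * \sum_(v in S) f (h v).
Proof. by rewrite /Ed /average big_map big_enum mulr_sumr. Qed.

Lemma Ed_average_cst (A : finType) (T : Type) (S : {set A}) (h : A -> T) f c :
  (0 < #|S|)%N -> (forall v, v \in S -> f (h v) = c) -> Ed (average S h) f = c.
Proof.
move=> S0 fc; rewrite Ed_average (eq_bigr (fun=> c)) //.
by rewrite sumr_const -[c *+ _]mulr_natl mulKf // pnatr_eq0 -lt0n.
Qed.

Lemma Ed_le (T : eqType) (d : seq (F * T)) f g :
  (forall p, p \in d -> 0 <= p.1 /\ f p.2 <= g p.2) -> Ed d f <= Ed d g.
Proof.
move=> h; rewrite /Ed !big_seq; apply: ler_sum => p /h[p0 fg].
exact: ler_wpM2l.
Qed.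

Lemma eq_Ed_in (T : eqType) (d : seq (F * T)) f g :
  (forall p, p \in d -> f p.2 = g p.2) -> Ed d f = Ed d g.
Proof.
by move=> h; rewrite /Ed !big_seq; apply: eq_bigr => p /h ->.
Qed.

Lemma eq_Ed (T : Type) (d : seq (F * T)) f g : f =1 g -> Ed d f = Ed d g.
Proof. by move=> h; apply: eq_bigr => p _; rewrite h. Qed.

Lemma EdZ (T : Type) (d : seq (F * T)) c f :
  Ed d (fun t => c * f t) = c * Ed d f.
Proof. by rewrite /Ed mulr_sumr; apply: eq_bigr => p _; ring. Qed.

Lemma EdD (T : Type) (d : seq (F * T)) f g :
  Ed d (fun t => f t + g t) = Ed d f + Ed d g.
Proof. by rewrite /Ed -big_split; apply: eq_bigr => p _; rewrite mulrDr. Qed.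

Lemma Ed_sum (T : Type) (d : seq (F * T)) (J : finType) (P : pred J)
    (f : J -> T -> F) :
  Ed d (fun t => \sum_(j | P j) f j t) = \sum_(j | P j) Ed d (f j).
Proof.
by rewrite /Ed exchange_big; apply: eq_bigr => p _; rewrite mulr_sumr.
Qed.

End WeightedSeq.

Section Spread.
Variables (F : realFieldType) (V R : finType).
Hypothesis R_gt0 : (0 < #|R|)%N.
Implicit Types (N : V -> {set R}) (xs : seq V) (phi : {ffun V -> R}).

Definition unif : R -> F := fun=> #|R|%:R^-1.

Lemma unif_distr : distr unif.
Proof.
split=> [l|]; first by rewrite invr_ge0.
by rewrite /unif sumr_const -[LHS]mulr_natl mulfV // pnatr_eq0 -lt0n.
Qed.

Definition avail N xs phi x : {set R} := N x :\: [set phi y | y in xs].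

(* A random system of distinct representatives of the sets [N x]; the images
   are chosen from the end of the list towards its head. *)
Fixpoint spread N xs phi : seq (F * {ffun V -> R}) :=
  if xs is x :: xs' then
    bind (spread N xs' phi)
      (fun psi => average F (avail N xs' psi x) (upd psi x))
  else [:: (1, phi)].

Fixpoint roomy N xs : bool :=
  if xs is x :: xs' then
    (2 * (size xs').+1 <= #|N x|)%N && roomy N xs'
  else true.

(** Each vertex of [xs] occupies at most one point of [N x]. The [.+1] leaves a free point even when
    [xs] is empty. *)
Lemma avail_ge N xs phi x :
  (2 * (size xs).+1 <= #|N x|)%N ->
  (0 < #|avail N xs phi x|)%N /\ (#|N x| <= 2 * #|avail N xs phi x|)%N.
Proof.
move=> h; have le1 : (#|N x| <= #|avail N xs phi x| + size xs)%N.
  rewrite -(cardsID [set phi y | y in xs] (N x)) addnC leq_add2l.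
  apply: leq_trans (subset_leq_card (subsetIr _ _)) _.
  by apply: leq_trans (leq_imset_card _ _) (card_size _).
by split; lia.
Qed.

Lemma spread_mass N xs phi : roomy N xs -> Ed (spread N xs phi) (fun=> 1) = 1.
Proof.
elim: xs => [|x xs IH] /=; first by rewrite /Ed big_seq1 mulr1.
case/andP=> h /IH e; rewrite Ed_bind -[RHS]e; apply: eq_Ed => psi.
by have [a0 _] := avail_ge psi h; exact: Ed_average_cst.
Qed.

Lemma spread_support N xs phi p : roomy N xs -> uniq xs ->
  p \in spread N xs phi ->
  [/\ 0 <= p.1, {in [predC xs], p.2 =1 phi},
      {in xs, forall x, p.2 x \in N x} & {in xs &, injective p.2}].
Proof.
elim: xs p => [|x xs IH] p /=; first by rewrite inE => _ _ /eqP ->; split.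
case/andP=> h ro /andP[xxs us] /allpairsPdep[q [r [qs rs ->]]] /=.
have [q0 qphi qN qi] := IH _ ro us qs.
case/mapP: rs => v; rewrite mem_enum => vA ->/=.
have [vN vn] : v \in N x /\ forall y, y \in xs -> v != q.2 y.
  move: vA; rewrite inE => /andP[vn ->]; split=> // y ys.
  by apply: contraNneq vn => ->; apply: imset_f.
have nx y : y \in xs -> (y == x) = false.
  by move=> ys; apply/negbTE; apply: contraNneq xxs => <-.
split.
- by rewrite mulr_ge0 // invr_ge0.
- move=> y; rewrite !inE negb_or ffunE => /andP[/negPf -> ys].
  by apply: qphi; rewrite inE.
- by move=> y; rewrite inE ffunE; case: eqP => [-> //|_ /= /qN].
- move=> y z; rewrite !inE !ffunE.
  case: (y =P x) => [->|_] /=; case: (z =P x) => [->|_] //=.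
  + by move=> _ zs e; have := vn _ zs; rewrite e eqxx.
  + by move=> ys _ e; have := vn _ ys; rewrite e eqxx.
  + exact: qi.
Qed.

(** Each image is uniform on at least half of [N x], so its density with respect to the uniform law
    on [R] is at most [2 * #|R| / #|N x|]. A vertex of [xs] outside [S] is not read by [G], and
    averaging over its image has mass one, so it costs no factor. *)
Lemma spread_dom N xs phi (S : {set V}) (G : {ffun V -> R} -> F) :
  roomy N xs -> uniq xs -> {subset S <= xs} ->
  dep_on (S :|: ~: [set x in xs]) G -> (forall u, 0 <= G u) ->
  Ed (spread N xs phi) G <= (\prod_(x in S) (2 * #|R|%:R / #|N x|%:R)) *
    Ex unif (fun eta => G (glue [set x in xs] phi eta)).
Proof.
have dU := unif_distr.
elim: xs S G => [|x xs IH] S G /=.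
  move=> _ _ S0 dG G0; have -> : S = set0.
    by apply/eqP; rewrite -subset0; apply/subsetP=> y /S0.
  rewrite big_set0 mul1r /Ed big_seq1 mul1r.
  rewrite (@eq_Ex _ _ _ _ _ (fun=> G phi)) ?Ex_cst // => u.
  by congr G; apply/ffunP=> i; rewrite ffunE inE.
case/andP=> h ro /andP[xxs us] Sxs dG G0; rewrite Ed_bind.
have [xS|xS] := boolP (x \in S); last first.
  have Sxs' : {subset S <= xs}.
    move=> y yS; have := Sxs _ yS; rewrite inE => /orP[/eqP yx|//].
    by rewrite -yx yS in xS.
  have Gu psi v : G (upd psi x v) = G psi.
    apply: dG => i; rewrite !inE ffunE; case: eqP => [->|//].
    by rewrite (negPf xS).
  rewrite (@eq_Ed _ _ _ _ G) => [|psi]; last first.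
    by have [a0 _] := avail_ge psi h; apply: Ed_average_cst.
  apply: le_trans (IH S G ro us Sxs' _ G0) _.
    apply: dep_on_sub dG; apply: setUS; rewrite setCS.
    by apply/subsetP=> i; rewrite !inE => ->; rewrite orbT.
  rewrite le_eqVlt; apply/orP; left; apply/eqP; congr (_ * _).
  apply: eq_Ex => eta; apply: dG => i; rewrite !inE !ffunE !inE.
  case: (i =P x) => [->|_] //=; by rewrite (negPf xS).
(* Averaging over a uniform image of [x] removes [x] from the coordinates read, so the induction
   hypothesis applies with [S :\ x]. *)
pose G' psi := Ex unif (fun eta => G (glue [set x] psi eta)).
have G'E psi : G' psi = #|R|%:R^-1 * \sum_v G (upd psi x v).
  rewrite /G' (@eq_Ex _ _ _ _ _ (fun eta => G (upd psi x (eta x)))).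
    by rewrite (Ex_coord x (fun v => G (upd psi x v)) dU) mulr_sumr.
  move=> eta; congr G; apply/ffunP=> i; rewrite !ffunE inE.
  by case: eqP => [->|].
have R0 : (0 : F) < #|R|%:R by rewrite ltr0n.
have N0 : (0 : F) < #|N x|%:R by rewrite ltr0n; apply: leq_trans h.
apply: (@le_trans _ _ (Ed (spread N xs phi)
   (fun psi => 2 * #|R|%:R / #|N x|%:R * G' psi))).
  apply: Ed_le => p /(spread_support ro us)[p0 _ _ _]; split=> //.
  have [a0 a2] := avail_ge p.2 h; rewrite Ed_average G'E.
  set Sv := \sum_v _; set c := #|avail _ _ _ _| in a0 a2 *.
  have -> : 2 * #|R|%:R / #|N x|%:R * (#|R|%:R^-1 * Sv) = 2 / #|N x|%:R * Sv.
    by field; rewrite !gt_eqF.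
  have c0 : (0 : F) < c%:R by rewrite ltr0n.
  apply: ler_pM; rewrite ?invr_ge0 ?ler0n ?sumr_ge0 //.
    rewrite ler_pdivlMr // mulrC ler_pdivrMr //.
    by rewrite -natrM ler_nat.
  rewrite /Sv [leRHS](bigID (mem (avail N xs p.2 x))) /= lerDl.
  exact: sumr_ge0.
rewrite EdZ (big_setD1 x) //= -[leRHS]mulrA.
apply: ler_wpM2l; first by rewrite divr_ge0 // mulr_ge0.
have Sxs' : {subset S :\ x <= xs}.
  by move=> y; rewrite !inE => /andP[/negPf yx /Sxs]; rewrite inE yx.
apply: le_trans (IH (S :\ x) G' ro us Sxs' _ _) _.
- move=> u v e; rewrite !G'E; congr (_ * _); apply: eq_bigr => l _.
  apply: dG => i; rewrite !inE !ffunE; case: (i =P x) => // /eqP ix /= iS.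
  by apply: e; rewrite !inE ix.
- by move=> u; apply: Ex_ge0.
rewrite le_eqVlt; apply/orP; left; apply/eqP; congr (_ * _).
rewrite -[RHS](Ex_glue [set x] _ dU); apply: eq_Ex => eta; apply: eq_Ex => zeta.
congr G; apply/ffunP=> i; rewrite !ffunE !inE; case: (i =P x) => //= _.
Qed.

End Spread.

(** * The random greedy process *)

(** The head has the largest set, so every term of the sum is at least [#|N x|^-1], and
    [(size xs).+1 / #|N x|] is at most one half. *)
Lemma roomy_sorted (F : realFieldType) (V R : finType) (N : V -> {set R}) xs :
  sorted (fun x y => #|N y| <= #|N x|)%N xs ->
  {in xs, forall x, (0 < #|N x|)%N} ->
  \sum_(x <- xs) (#|N x|%:R^-1 : F) <= 2^-1 -> roomy N xs.
Proof.
elim: xs => //= x xs IH pxs N0; rewrite big_cons => le2.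
have tr : transitive (fun x y => #|N y| <= #|N x|)%N.
  by move=> y z t zy yt; apply: leq_trans yt zy.
have Nx0 : (0 : F) < #|N x|%:R by rewrite ltr0n N0 ?mem_head.
apply/andP; split; last first.
  apply: IH; first exact: path_sorted pxs.
    by move=> y yxs; rewrite N0 // inE yxs orbT.
  by apply: le_trans le2; rewrite lerDr invr_ge0 ltW.
rewrite -(ler_nat F) natrM; move: le2.
have : (size xs)%:R / #|N x|%:R <= \sum_(y <- xs) (#|N y|%:R^-1 : F).
  have -> : (size xs)%:R / #|N x|%:R = \sum_(y <- xs) (#|N x|%:R^-1 : F).
    by rewrite big_const_seq count_predT iter_addr_0 mulr_natl.
  rewrite !big_seq; apply: ler_sum => y yxs.
  have Ny0 : (0 < #|N y|)%N by rewrite N0 // inE yxs orbT.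
  rewrite lef_pV2 ?posrE ?ltr0n // ?ler_nat; last exact: leq_trans (allP (order_path_min tr pxs) _ yxs).
  exact: (allP (order_path_min tr pxs)).
move=> h1 h2; have {h1 h2} : (size xs).+1%:R / #|N x|%:R <= (2^-1 : F).
  by apply: le_trans h2; rewrite -natr1 mulrDl mul1r addrC lerD2l.
by rewrite ler_pdivrMr // mulrC; lra.
Qed.

Section Process.
Variables (F : realFieldType) (V R : finType) (ord : V -> nat).
Variables (B : V -> {set V}) (a : V -> F) (s : nat) (phi0 : {ffun V -> R}).
Variable cand : V -> {ffun V -> R} -> {set R}.
Hypothesis s_gt0 : (0 < s)%N.
Hypothesis R_gt0 : (0 < #|R|)%N.
Hypothesis B_ord : forall x y, y \in B x -> (ord y < ord x)%N.
Hypothesis a_gt0 : forall x, 0 < a x.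
Hypothesis cand_dep : forall x, dep_on (B x) (cand x).
Hypothesis cand_disj : forall x y phi psi v,
  v \in cand x phi -> v \in cand y psi -> ord x = ord y.

(* [delta x phi / a x] bounds the probability that the process gives [x] any
   fixed image; the shift by [s] keeps inverse moments of order [s] finite even
   for an empty set of candidates. *)
Definition delta x phi : F :=
  1 + 2 * s.+1%:R * a x / (#|cand x phi| + s)%:R.

Definition layer c : {set V} := [set x | ord x == c].
Definition below c : {set V} := [set x | (ord x < c)%N].

(** By [delta_inv], this makes the inverse numbers of candidates over the layer sum to at most one
    half, as the greedy choice of distinct representatives requires. *)
Definition hall c phi : bool := \sum_(x in layer c) delta x phi / a x <= 1.

Definition layer_seq c phi :=
  sort (fun x y => #|cand y phi| <= #|cand x phi|)%N (enum (layer c)).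

(* The mass of the states that violate [hall] is discarded. *)
Definition step c phi : seq (F * {ffun V -> R}) :=
  if hall c phi then spread F (cand^~ phi) (layer_seq c phi) phi else [::].

Fixpoint proc c : seq (F * {ffun V -> R}) :=
  if c is c'.+1 then bind (proc c') (step c') else [:: (1, phi0)].

Lemma delta_ge1 x phi : 1 <= delta x phi.
Proof. by rewrite lerDl divr_ge0 // !mulr_ge0 // ltW. Qed.

Lemma delta_gt0 x phi : 0 < delta x phi.
Proof. exact: lt_le_trans ltr01 (delta_ge1 x phi). Qed.

Lemma delta_dep x : dep_on (B x) (delta x).
Proof. by move=> u v e; rewrite /delta (cand_dep e). Qed.

Lemma B_below x : B x \subset below (ord x).
Proof. by apply/subsetP=> y /B_ord; rewrite inE. Qed.

Lemma layer_set c phi : [set x in layer_seq c phi] = layer c.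
Proof. by apply/setP=> x; rewrite inE mem_sort mem_enum. Qed.

Lemma mem_layer_seq c phi x : (x \in layer_seq c phi) = (ord x == c).
Proof. by rewrite mem_sort mem_enum inE. Qed.

Lemma layer_seq_uniq c phi : uniq (layer_seq c phi).
Proof. by rewrite sort_uniq enum_uniq. Qed.

(** With [n] candidates, [n >= 1], one has [n + s <= (s + 1) * n]; this is what the factor [s.+1] in
    [delta] is for. *)
Lemma delta_inv x phi : (0 < #|cand x phi|)%N ->
  2 / #|cand x phi|%:R <= delta x phi / a x.
Proof.
rewrite /delta; set n := #|_| => n0; have a0 := a_gt0 x.
have n0' : (1 : F) <= n%:R by rewrite ler1n.
have s0 : (0 : F) <= s%:R by rewrite ler0n.
rewrite natrD -(natr1 s) [leRHS]mulrDl mul1r.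
have -> : 2 * (s%:R + 1) * a x / (n%:R + s%:R) / a x
   = 2 * ((s%:R + 1) / (n%:R + s%:R)) by field; rewrite gt_eqF //=; lra.
have : n%:R^-1 <= (s%:R + 1) / (n%:R + s%:R) :> F.
  rewrite ler_pdivlMr; last lra.
  rewrite mulrC ler_pdivrMr; last lra.
  nra.
have : 0 < (a x)^-1 by rewrite invr_gt0.
lra.
Qed.

(** An empty candidate set alone would contribute more than [2 * s.+1 / s > 1] to the sum in
    [hall]. *)
Lemma hall_cand c phi x : hall c phi -> ord x = c -> (0 < #|cand x phi|)%N.
Proof.
rewrite /hall => le1 xc; rewrite lt0n; apply/negP=> /eqP n0.
move: le1; rewrite (bigD1 x) ?inE ?xc //= /delta n0 add0n.
set t := \sum_(_ | _) _.
have t0 : 0 <= t.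
  by apply: sumr_ge0 => y _; rewrite divr_ge0 ?(ltW (a_gt0 _)) ?ltW ?delta_gt0.
have a0 := a_gt0 x.
have s0 : (0 : F) < s%:R by rewrite ltr0n.
rewrite mulrDl mul1r -(natr1 s).
have -> : 2 * (s%:R + 1) * a x / s%:R / a x = 2 + 2 / s%:R.
  by field; rewrite !gt_eqF.
have : 0 < 2 / s%:R :> F by rewrite divr_gt0.
have : 0 < (a x)^-1 by rewrite invr_gt0.
lra.
Qed.

Lemma hall_roomy c phi : hall c phi -> roomy (cand^~ phi) (layer_seq c phi).
Proof.
move=> hc; apply: (@roomy_sorted F).
- by apply: sort_sorted => x y; exact: leq_total.
- by move=> x; rewrite mem_layer_seq => /eqP; apply: hall_cand.
have -> : \sum_(x <- layer_seq c phi) (#|cand x phi|%:R^-1 : F)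
          = \sum_(x in layer c) #|cand x phi|%:R^-1.
  by rewrite -[RHS]big_enum; apply: perm_big; rewrite perm_sort.
suff : 2 * \sum_(x in layer c) #|cand x phi|%:R^-1 <= 1 :> F by lra.
rewrite mulr_sumr; apply: (le_trans _ hc); apply: ler_sum => x.
by rewrite inE => /eqP xc; apply: delta_inv; exact: (hall_cand hc).
Qed.

Lemma step_support c phi p : p \in step c phi ->
  [/\ hall c phi, 0 <= p.1, {in [predC layer c], p.2 =1 phi},
      {in layer c, forall x, p.2 x \in cand x phi}
      & {in layer c &, injective p.2}].
Proof.
rewrite /step; case: ifP => // hc.
case/(spread_support (hall_roomy hc) (layer_seq_uniq c phi)) => p0 pp pN pi.
have e x : (x \in layer_seq c phi) = (x \in layer c).
  by rewrite mem_layer_seq inE.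
split=> // [x|x|x y].
- by rewrite inE -e => ?; apply: pp; rewrite inE.
- by rewrite -e; apply: pN.
- by rewrite -!e; apply: pi.
Qed.

(** Candidate sets read only images from earlier layers, which later steps leave unchanged. A
    coincidence of images forces equal [ord] by [cand_disj], and within one layer the
    representatives are distinct. *)
Lemma proc_support c p : p \in proc c ->
  [/\ 0 <= p.1, {in below c, forall x, p.2 x \in cand x p.2}
      & {in below c &, injective p.2}].
Proof.
elim: c p => [|c IH] p /=.
  rewrite inE => /eqP -> /=; split=> // x; first by rewrite inE.
  by move=> y; rewrite inE.
case/allpairsPdep=> q [r [/IH[q0 qc qi]]] /step_support[hc r0 rq rc ri] ->/=.
have rqB x : ord x = c -> cand x r.2 = cand x q.2.
  move=> xc; apply: cand_dep => y /B_ord; rewrite xc => yc.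
  by apply: rq; rewrite !inE neq_ltn yc.
have rq' x : (ord x < c)%N -> r.2 x = q.2 x.
  by move=> xc; apply: rq; rewrite !inE neq_ltn xc.
have rqB' x : (ord x < c)%N -> cand x r.2 = cand x q.2.
  move=> xc; apply: cand_dep => y /B_ord yx.
  by apply: rq; rewrite !inE neq_ltn (ltn_trans yx).
have rc' x : (ord x < c.+1)%N -> r.2 x \in cand x q.2.
  rewrite ltnS leq_eqVlt => /orP[xc|xc]; first by apply: rc; rewrite inE.
  by rewrite rq' // qc // inE.
split; first exact: mulr_ge0.
- move=> x; rewrite inE => xc; move: (rc' x xc); move: xc.
  by rewrite ltnS leq_eqVlt => /orP[/eqP/rqB -> | /rqB' ->].
move=> x y; rewrite !inE => xc yc exy.
have oxy : ord x = ord y.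
  by apply: cand_disj (rc' _ xc) _; rewrite exy; apply: rc'.
move: xc; rewrite ltnS leq_eqVlt => /orP[xc|xc].
  by apply: ri exy; rewrite inE -?oxy.
by move: exy; rewrite !rq' -?oxy // => exy; apply: qi exy; rewrite inE -?oxy.
Qed.

Lemma step_mass c phi : Ed (step c phi) (fun=> 1) = (hall c phi)%:R.
Proof.
rewrite /step; case: ifP => hc; last by rewrite /Ed big_nil.
by rewrite spread_mass // hall_roomy.
Qed.

Lemma step_below c phi f : dep_on (below c) f ->
  Ed (step c phi) f = (hall c phi)%:R * f phi.
Proof.
move=> df; rewrite -step_mass mulrC -EdZ; apply: eq_Ed_in => p.
case/step_support=> _ _ e _ _; rewrite mulr1; apply: df => x.
by rewrite inE => xc; apply: e; rewrite !inE neq_ltn xc.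
Qed.

(** Further steps do not touch the coordinates read by [f] and can only discard mass. *)
Lemma proc_later c c' f : (c <= c')%N -> dep_on (below c) f ->
  (forall u, 0 <= f u) -> Ed (proc c') f <= Ed (proc c) f.
Proof.
move=> cc' df f0; elim: c' cc' => [|c' IH].
  by rewrite leqn0 => /eqP ->.
rewrite leq_eqVlt => /orP[/eqP -> //|cc']; apply: le_trans (IH cc') => /=.
rewrite Ed_bind; apply: Ed_le => p /proc_support[p0 _ _]; split=> //.
rewrite step_below; first by case: hall; rewrite ?mul1r ?mul0r.
by apply: dep_on_sub df; apply/subsetP=> x; rewrite !inE => xc; lia.
Qed.

(** Markov's inequality for one step: mass is lost only where [hall] fails, and there the subtracted
    sum exceeds 1. *)
Lemma proc_mass c :
  Ed (proc c) (fun=> 1)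
    - Ed (proc c) (fun phi => \sum_(x in layer c) delta x phi / a x)
  <= Ed (proc c.+1) (fun=> 1).
Proof.
rewrite lerBlDr /= Ed_bind -EdD; apply: Ed_le => p /proc_support[p0 _ _].
split=> //; rewrite step_mass; have [_|] := boolP (hall c p.2); last first.
  by rewrite mulr0n add0r -ltNge => /ltW.
rewrite lerDl; apply: sumr_ge0 => x _.
by rewrite divr_ge0 ?(ltW (a_gt0 _)) ?(ltW (delta_gt0 _ _)).
Qed.

(* Weighting by the inverse of every [delta] compensates the bias of the
   process: the images of [S] are then dominated by uniform ones. *)
Lemma proc_dom c (S : {set V}) G : S \subset below c -> dep_on S G ->
  (forall u, 0 <= G u) ->
  Ed (proc c) (fun phi => (\prod_(y in S) (delta y phi)^-1) * G phi) <=
    (\prod_(y in S) (#|R|%:R / a y)) * Ex (unif F (R := R)) G.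
Proof.
have dU := unif_distr F R_gt0.
elim: c S G => [|c IH] S G Sc dG G0.
  have S0 : S = set0.
    by apply/eqP; rewrite -subset0; apply/subsetP=> x /(subsetP Sc); rewrite inE.
  rewrite S0 /= /Ed big_seq1 !big_set0 !mul1r (@eq_Ex _ _ _ _ _ (fun=> G phi0)) ?Ex_cst //.
  by move=> u; apply: dG => x; rewrite S0 inE.
pose S1 := S :&: below c; pose S2 := S :&: layer c.
have SE (f : V -> F) : \prod_(y in S) f y = (\prod_(y in S1) f y) * (\prod_(y in S2) f y).
  rewrite (bigID (mem (below c))) /=; congr (_ * _); apply: eq_bigl => x.
    by rewrite !inE.
  rewrite !inE; have [xS|//] := boolP (x \in S).
  by have := subsetP Sc x xS; rewrite inE /=; lia.
(* Making the images of layer [c] uniform leaves a function of the images of [S1] alone, to which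
   the induction hypothesis applies. *)
pose G' phi := Ex (unif F (R := R)) (fun eta => G (glue (layer c) phi eta)).
have le1 : Ed (proc c.+1) (fun phi => (\prod_(y in S) (delta y phi)^-1) * G phi)
   <= Ed (proc c) (fun phi => (\prod_(y in S2) (#|R|%:R / a y)) *
          ((\prod_(y in S1) (delta y phi)^-1) * G' phi)).
  rewrite [proc c.+1]/= Ed_bind; apply: Ed_le => p /proc_support[p0 _ _].
  split=> //; set phi := p.2.
  have pge0 (T : {set V}) : 0 <= \prod_(y in T) (delta y phi)^-1.
    by apply: prodr_ge0 => y _; rewrite invr_ge0 ltW ?delta_gt0.
  have G'0 : 0 <= G' phi by apply: Ex_ge0.
  have [hc|hc] := boolP (hall c phi); last first.
    rewrite /step (negPf hc) /Ed big_nil mulr_ge0 ?mulr_ge0 //.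
    by apply: prodr_ge0 => y _; rewrite divr_ge0 // ltW.
  apply: (@le_trans _ _ (Ed (step c phi)
     (fun psi => (\prod_(y in S) (delta y phi)^-1) * G psi))).
    apply: Ed_le => q /step_support[_ q0 qe _ _]; split=> //.
    rewrite le_eqVlt; apply/orP; left; apply/eqP; congr (_ * _).
    apply: eq_bigr => y /(subsetP Sc); rewrite inE => yc.
    congr (_^-1); apply: delta_dep => z /B_ord zy; apply: qe.
    by rewrite !inE neq_ltn (leq_trans zy).
  rewrite EdZ /step hc SE.
  have Sl : {subset S2 <= layer_seq c phi}.
    by move=> x; rewrite mem_layer_seq !inE => /andP[].
  have sd : Ed (spread F (cand^~ phi) (layer_seq c phi) phi) G
      <= (\prod_(y in S2) (2 * #|R|%:R / #|cand y phi|%:R)) * G' phi.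
    rewrite /G' -(layer_set c phi).
    apply: (spread_dom R_gt0 phi (hall_roomy hc) (layer_seq_uniq c phi) Sl _ G0).
    apply: dep_on_sub dG; apply/subsetP=> x xS.
    by rewrite !inE mem_layer_seq xS /=; case: eqP.
  (* By [delta_inv], each inverse [delta] absorbs the factor [2 / #|cand y phi|] of the density
     bound and leaves [#|R| / a y]. *)
  have p2 : (\prod_(y in S2) (delta y phi)^-1) *
      (\prod_(y in S2) (2 * #|R|%:R / #|cand y phi|%:R))
      <= \prod_(y in S2) (#|R|%:R / a y).
    rewrite -big_split; apply: ler_prod => y; rewrite !inE => /andP[_ /eqP yc] /=.
    have n0 := hall_cand hc yc; have := delta_inv n0.
    have d0 := delta_gt0 y phi; have a0 := a_gt0 y.
    have n0' : (0 : F) < #|cand y phi|%:R by rewrite ltr0n.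
    rewrite mulr_ge0 ?invr_ge0 ?divr_ge0 ?mulr_ge0 ?(ltW d0) //=.
    rewrite ler_pdivlMr // => le2.
    rewrite mulrC ler_pdivrMr //.
    have -> : 2 * #|R|%:R / #|cand y phi|%:R
      = #|R|%:R / a y * (2 / #|cand y phi|%:R * a y) :> F.
      by field; rewrite !gt_eqF.
    by apply: ler_wpM2l => //; rewrite divr_ge0 // ltW.
  set P1 := \prod_(y in S1) _; set P2 := \prod_(y in S2) (delta y phi)^-1.
  apply: (@le_trans _ _ (P1 * P2 * ((\prod_(y in S2)
      (2 * #|R|%:R / #|cand y phi|%:R)) * G' phi))).
    by apply: ler_wpM2l => //; rewrite mulr_ge0 ?pge0.
  set Q := \prod_(y in S2) (2 * #|R|%:R / #|cand y phi|%:R) in p2 *.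
  have -> : P1 * P2 * (Q * G' phi) = P2 * Q * (P1 * G' phi) by ring.
  by apply: ler_wpM2r => //; rewrite mulr_ge0 ?pge0.
apply: (le_trans le1); rewrite EdZ SE [X in _ <= X * _]mulrC -mulrA.
apply: ler_wpM2l.
  by apply: prodr_ge0 => y _; rewrite divr_ge0 // ltW.
have -> : Ex (unif F (R:=R)) G = Ex (unif F (R:=R)) G'.
  by rewrite -(Ex_glue (layer c) G dU).
apply: IH; first exact: subsetIr.
  move=> u v e; apply: eq_Ex => eta; apply: dG => x xS; rewrite !ffunE.
  case: ifP => // xl; apply: e; rewrite inE xS /=.
  by have := subsetP Sc x xS; move: xl; rewrite !inE; lia.
by move=> u; apply: Ex_ge0.
Qed.

End Process.

(** * Moments of the process *)

(** The product is at most the [D]-th power of its largest factor; the summand 1 covers the empty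
    product. *)
Lemma prod_le_sum_exp (F : realFieldType) (V : finType) (S : {set V})
    (f : V -> F) D :
  (#|S| <= D)%N -> (forall x, 1 <= f x) ->
  \prod_(x in S) f x <= 1 + \sum_(x in S) f x ^+ D.
Proof.
move=> SD f1; have [->|[x0 x0S]] := set_0Vmem S.
  by rewrite !big_set0 addr0.
have [x xS xmax] := arg_maxP f x0S.
apply: (@le_trans _ _ (f x ^+ D)).
  apply: (@le_trans _ _ (\prod_(y in S) f x)).
    apply: ler_prod => y yS; rewrite (le_trans ler01 (f1 y)) /=.
    exact: xmax.
  by rewrite prodr_const; apply: ler_weXn2l.
rewrite (bigD1 x) //= addrCA lerDl addr_ge0 // sumr_ge0 // => y _.
by rewrite exprn_ge0 // (le_trans ler01).
Qed.

Section Embedding.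
Variables (F : realFieldType) (V R Om : finType) (ord : V -> nat).
Variables (B : V -> {set V}) (a : V -> F) (D : nat) (w : Om -> F) (K : F).
Variables (cand : Om -> V -> {ffun V -> R} -> {set R}).
(** A uniform [phi] may lack properties shared by all states of the process; [valid] restricts the
    moment hypothesis to those [phi] that have them. *)
Variable valid : Om -> V -> {ffun V -> R} -> bool.
Hypothesis D_gt0 : (0 < D)%N.
Hypothesis R_gt0 : (0 < #|R|)%N.
Hypothesis B_ord : forall x y, y \in B x -> (ord y < ord x)%N.
Hypothesis B_card : forall x, (#|B x| <= D)%N.
Hypothesis a_gt0 : forall x, 0 < a x.
Hypothesis cand_dep : forall om x, dep_on (B x) (cand om x).
Hypothesis cand_disj : forall om x y phi psi v,
  v \in cand om x phi -> v \in cand om y psi -> ord x = ord y.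
Hypothesis valid_dep : forall om x, dep_on (B x) (valid om x).
Hypothesis valid_cand : forall om x (phi : {ffun V -> R}), 0 < w om ->
  {in B x, forall y, phi y \in cand om y phi} -> {in B x &, injective phi} ->
  valid om x phi.
Hypothesis w_ge0 : forall om, 0 <= w om.
Hypothesis w_sum : \sum_om w om = 1.
Hypothesis K_ge1 : 1 <= K.

Local Notation dlt := (fun om => delta a (2 * D) (cand om)).

Hypothesis moment : forall x,
  \sum_om w om * ((\prod_(y in B x) (#|R|%:R / a y)) *
    Ex (unif F (R := R)) (fun phi => (valid om x phi)%:R * dlt om x phi ^+ (2 * D)))
  <= K.

Variable phi0 : {ffun V -> R}.

Let P om c := proc ord a (2 * D) phi0 (cand om) c.
Let EP c (f : Om -> {ffun V -> R} -> F) := \sum_om w om * Ed (P om c) (f om).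

Let s_gt0 : (0 < 2 * D)%N. Proof. by rewrite muln_gt0. Qed.

Let EP_le c f g : (forall om p, 0 < w om -> p \in P om c -> f om p.2 <= g om p.2) ->
  EP c f <= EP c g.
Proof.
move=> fg; apply: ler_sum => om _; have := w_ge0 om.
rewrite le_eqVlt => /orP[/eqP <-|w0]; first by rewrite !mul0r.
apply: ler_wpM2l => //; apply: Ed_le => p pP; split; last exact: fg.
by have [] := proc_support s_gt0 B_ord a_gt0 (cand_dep om) (@cand_disj om) pP.
Qed.

Let EPD c f g : EP c (fun om u => f om u + g om u) = EP c f + EP c g.
Proof. by rewrite -big_split; apply: eq_bigr => om _; rewrite EdD mulrDr. Qed.

Let EPZ c k f : EP c (fun om u => k * f om u) = k * EP c f.
Proof. by rewrite /EP mulr_sumr; apply: eq_bigr => om _; rewrite EdZ; ring. Qed.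

Let EP_sum c (I : finType) (Q : pred I) (f : I -> Om -> {ffun V -> R} -> F) :
  EP c (fun om u => \sum_(i | Q i) f i om u) = \sum_(i | Q i) EP c (f i).
Proof.
rewrite exchange_big; apply: eq_bigr => om _; by rewrite Ed_sum mulr_sumr.
Qed.

Let dlt1 om x u : 1 <= dlt om x u. Proof. exact: delta_ge1. Qed.

Let dlt0 om x u : 0 < dlt om x u. Proof. exact: lt_le_trans ltr01 (dlt1 _ _ _). Qed.

Let EP_later c c' f : (c <= c')%N -> (forall om, dep_on (below ord c) (f om)) ->
  (forall om u, 0 <= f om u) -> EP c' f <= EP c f.
Proof.
move=> cc' df f0; apply: ler_sum => om _; apply: ler_wpM2l => //.
exact: (proc_later phi0 s_gt0 R_gt0 B_ord a_gt0 (cand_dep om) (@cand_disj om)).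
Qed.

Let EP1 c : EP c (fun _ _ => 1) <= 1.
Proof.
apply: le_trans (EP_later (leq0n c) _ _) _ => //.
rewrite -[leRHS]w_sum; apply: ler_sum => om _.
by rewrite /P /= /Ed big_seq1 !mulr1.
Qed.

Let M : F := D.+1%:R * K.

Let M_ge1 : 1 <= M.
Proof. by rewrite -[1]mulr1 ler_pM // ler1n. Qed.

(* AM-GM between [delta ^ D] weighted by the inverse product [W^-1] of the
   earlier deltas, where the images are dominated by uniform ones, and [W]
   itself, which is bounded by the moments of the earlier vertices. *)
Let delta_moment x : EP (ord x) (fun om u => dlt om x u ^+ D) <= M.
Proof.
have [n] := ubnP (ord x); elim: n x => // n IH x xn.
pose W om u : F := \prod_(y in B x) dlt om y u.
have W0 om u : 0 < W om u by apply: prodr_gt0 => y _; apply: dlt0.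
(* The weight in AM-GM. The two expectations are at most [K] and [1 + D * M <= c * M], and
   [c / 2 * K + (2 * c)^-1 * (c * M)] is exactly [M = c * K], which closes the induction. *)
set c : F := D.+1%:R; have c0 : 0 < c by rewrite ltr0n.
have step1 : EP (ord x) (fun om u => dlt om x u ^+ D) <=
   EP (ord x) (fun om u => c / 2 * ((\prod_(y in B x) (dlt om y u)^-1) *
        ((valid om x u)%:R * dlt om x u ^+ (2 * D))) + (2 * c)^-1 * W om u).
  apply: EP_le => om p w0 pP.
  have [_ pc pi] := proc_support s_gt0 B_ord a_gt0 (cand_dep om) (@cand_disj om) pP.
  have Bb := subsetP (B_below B_ord x).
  rewrite valid_cand //=; first last.
  - by move=> y z yB zB; apply: pi; apply: Bb.
  - by move=> y yB; apply: pc; apply: Bb.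
  rewrite mul1r prodfV -/(W om p.2) mulnC exprM.
  set z := _ ^+ D; have Wp := W0 om p.2; set W1 := W _ _ in Wp *.
  have -> : c / 2 * (W1^-1 * z ^+ 2) + (2 * c)^-1 * W1
      = z + (c * z - W1) ^+ 2 / (2 * c * W1).
    by field; rewrite nat1r !gt_eqF.
  by rewrite lerDl divr_ge0 ?sqr_ge0 // !mulr_ge0 // ltW.
apply: (le_trans step1); rewrite EPD !EPZ.
have le1 : EP (ord x) (fun om u => (\prod_(y in B x) (dlt om y u)^-1) *
        ((valid om x u)%:R * dlt om x u ^+ (2 * D))) <= K.
  apply: le_trans (moment x); apply: ler_sum => om _; apply: ler_wpM2l => //.
  apply: (proc_dom phi0 s_gt0 R_gt0 B_ord a_gt0 (cand_dep om) (@cand_disj om)).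
  - exact: B_below.
  - by move=> u v e; rewrite (@valid_dep om x u v e) (delta_dep _ _ (@cand_dep om) e).
  - by move=> u; rewrite mulr_ge0 // exprn_ge0 // ltW.
have le2 : EP (ord x) W <= 1 + D%:R * M.
  apply: (@le_trans _ _ (EP (ord x) (fun om u => 1 + \sum_(y in B x) dlt om y u ^+ D))).
    by apply: EP_le => om p _ _; apply: prod_le_sum_exp.
  rewrite EPD lerD ?EP1 // EP_sum.
  apply: (@le_trans _ _ (\sum_(y in B x) M)).
    apply: ler_sum => y yB; have yx := B_ord yB.
    apply: le_trans (IH y (leq_trans yx xn)).
    apply: EP_later; first exact: ltnW.
    - move=> om u v e; congr (_ ^+ _); apply: (delta_dep _ _ (@cand_dep om)) => z.
      by move/(subsetP (B_below B_ord y)); apply: e.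
    - by move=> om u; rewrite exprn_ge0 // ltW.
  rewrite sumr_const -[_ *+ _]mulr_natl ler_wpM2r ?ler_nat //.
  exact: le_trans ler01 M_ge1.
apply: (@le_trans _ _ (c / 2 * K + (2 * c)^-1 * (1 + D%:R * M))).
  apply: lerD; first by apply: ler_wpM2l => //; rewrite divr_ge0 // ltW.
  by apply: ler_wpM2l => //; rewrite invr_ge0 mulr_ge0 // ltW.
apply: (@le_trans _ _ (c / 2 * K + (2 * c)^-1 * (c * M))).
  rewrite lerD2l; apply: ler_wpM2l; first by rewrite invr_ge0 mulr_ge0 // ltW.
  by have := M_ge1; rewrite /c -(natr1 D); lra.
rewrite /M -/c le_eqVlt; apply/orP; left; apply/eqP; field.
by rewrite nat1r gt_eqF.
Qed.

(** The losses of [proc_mass] are summed over the layers. The first moment of [delta] is at most its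
    [D]-th moment because [delta >= 1] and [D > 0]. *)
Let EP_mass c :
  1 - \sum_(x in below ord c) M / a x <= EP c (fun _ _ => 1).
Proof.
elim: c => [|c IH].
  rewrite big1 => [|x]; last by rewrite inE.
  rewrite subr0 -[leLHS]w_sum; apply: ler_sum => om _.
  by rewrite /P /= /Ed big_seq1 !mulr1.
have : EP c (fun _ _ => 1) - EP c (fun om u => \sum_(x in layer ord c) dlt om x u / a x)
   <= EP c.+1 (fun _ _ => 1).
  rewrite /EP -sumrB; apply: ler_sum => om _; rewrite -mulrBr.
  apply: ler_wpM2l => //.
  exact: (proc_mass phi0 s_gt0 R_gt0 B_ord a_gt0 (cand_dep om) (@cand_disj om)).
apply: le_trans.
have -> : \sum_(x in below ord c.+1) M / a x =
   \sum_(x in below ord c) M / a x + \sum_(x in layer ord c) M / a x.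
  rewrite (bigID (mem (below ord c))) /=; congr (_ + _); apply: eq_bigl => x;
  rewrite !inE; lia.
rewrite opprD addrA lerB // EP_sum; apply: ler_sum => x; rewrite inE => /eqP xc.
rewrite -xc.
have -> : EP (ord x) (fun om u => dlt om x u / a x)
   = (a x)^-1 * EP (ord x) (fun om u => dlt om x u).
  rewrite -EPZ; apply: eq_bigr => om _; congr (_ * _); apply: eq_Ed => u.
  by rewrite mulrC.
rewrite mulrC ler_wpM2r ?invr_ge0 ?(ltW (a_gt0 x)) //.
apply: le_trans (delta_moment x); apply: EP_le => om p _ _.
by rewrite -[leLHS]expr1; apply: ler_weXn2l.
Qed.

(** Less than the whole mass is lost over all layers, so for some [om] of positive weight a state
    survives, and [proc_support] describes it. *)
Lemma random_greedy_embedding : \sum_x D.+1%:R * K / a x < 1 ->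
  exists om (phi : {ffun V -> R}),
    [/\ 0 < w om, injective phi & forall x, phi x \in cand om x phi].
Proof.
move=> lt1; pose c := (\max_x ord x).+1.
have bc x : x \in below ord c by rewrite inE ltnS (leq_bigmax x).
have : 0 < EP c (fun _ _ => 1).
  apply: lt_le_trans (EP_mass c); rewrite subr_gt0.
  by rewrite (eq_bigl xpredT) // => x; rewrite bc.
move=> Egt; have [om wom] : exists om, 0 < w om * Ed (P om c) (fun=> 1).
  apply/existsP; apply: contraTT Egt => /existsPn h; rewrite -leNgt.
  by apply: sumr_le0 => om _; have := h om; rewrite -leNgt.
have w0 : 0 < w om.
  by rewrite lt_def w_ge0 andbT; apply: contraTneq wom => ->; rewrite mul0r ltxx.
have : P om c != [::].
  by apply: contraTneq wom => ->; rewrite /Ed big_nil mulr0 ltxx.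
case E : (P om c) => [|p l] // _.
have pP : p \in P om c by rewrite E mem_head.
have [_ pc pi] := proc_support s_gt0 B_ord a_gt0 (cand_dep om) (@cand_disj om) pP.
exists om, p.2; split=> // [x y e|x]; last exact: pc.
by apply: pi e.
Qed.

End Embedding.

(** * Degenerate graphs and Ramsey's theorem *)

Local Close Scope ring_scope.

Section Degenerate.
Variables (V : finType) (e : rel V) (d : nat).
Hypothesis e_sym : symmetric e.
Hypothesis e_deg : forall S : {set V}, S != set0 ->
  exists2 v, v \in S & (#|[set u in S | e v u]| <= d)%N.

Lemma degree_sum (S : {set V}) v :
  #|[set u in S | e v u]| = \sum_(u in S) (e v u : nat).
Proof.
rewrite -sum1_card (eq_bigl (fun u => (u \in S) && e v u)) => [|u]; last by rewrite inE.
by rewrite big_mkcondr; apply: eq_bigr => u _; case: (e v u).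
Qed.

(** Removing a vertex with at most [d] neighbours in [S] lowers the degree sum by at most
    [2 * d]. *)
Lemma degenerate_degree_sum (S : {set V}) :
  (\sum_(v in S) #|[set u in S | e v u]| <= 2 * d * #|S|)%N.
Proof.
have [n] := ubnP #|S|; elim: n S => // n IH S Sn.
have [->|S0] := eqVneq S set0; first by rewrite big_set0.
have [v vS dv] := e_deg S0.
have Sv := cardsD1 v S; rewrite vS in Sv.
have le2 : (\sum_(i in S :\ v) e i v <= d)%N.
  rewrite (eq_bigr (fun i => e v i : nat)) => [|i _]; last by rewrite e_sym.
  rewrite -degree_sum; apply: leq_trans (subset_leq_card _) dv.
  by apply/subsetP=> u; rewrite !inE => /andP[/andP[_ ->]].
rewrite (big_setD1 v) //=.
have -> : \sum_(i in S :\ v) #|[set u in S | e i u]|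
   = \sum_(i in S :\ v) e i v + \sum_(i in S :\ v) #|[set u in S :\ v | e i u]|.
  rewrite -big_split; apply: eq_bigr => i _ /=.
  by rewrite !degree_sum (big_setD1 v).
have le3 := IH (S :\ v) (leq_trans (leqnn _) _); rewrite Sv.
have /le3 : (#|S :\ v| < n)%N by rewrite -ltnS; apply: leq_trans Sn; rewrite Sv.
lia.
Qed.

(** Greedy colouring: a vertex of degree at most [d] is coloured last and sees at most [d] of the
    [d.+1] colours. *)
Lemma degenerate_coloring : irreflexive e ->
  exists t : V -> 'I_d.+1, forall u v, e u v -> t u != t v.
Proof.
move=> e_irr; suff h (S : {set V}) : exists t : V -> 'I_d.+1,
    {in S &, forall u v, e u v -> t u != t v}.
  by have [t ht] := h setT; exists t => u v; apply: ht; rewrite inE.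
have [n] := ubnP #|S|; elim: n S => // n IH S Sn.
have [->|S0] := eqVneq S set0; first by exists (fun=> ord0) => u v; rewrite inE.
have [v vS dv] := e_deg S0.
have Sv := cardsD1 v S; rewrite vS in Sv.
have [|t ht] := IH (S :\ v); first by rewrite -ltnS; apply: leq_trans Sn; rewrite Sv.
have [c hc] : exists c, c \notin t @: [set u in S | e v u].
  apply/existsP; apply: contraTT dv => /existsPn h; rewrite -ltnNge.
  apply: leq_trans (leq_imset_card t _); rewrite -[X in (X <= _)%N]card_ord.
  by apply: subset_leq_card; apply/subsetP=> c _; have := h c; rewrite negbK.
have hc' u : u \in S -> e v u -> c != t u.
  by move=> uS evu; apply: contraNneq hc => ->; apply: imset_f; rewrite inE uS.
exists (fun u => if u == v then c else t u) => x y xS yS exy.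
case: (x =P v) => [xv|/eqP xv]; case: (y =P v) => [yv|/eqP yv].
- by rewrite xv yv e_irr in exy.
- by apply: hc'; rewrite -?xv.
- by rewrite eq_sym; apply: hc'; rewrite // e_sym -yv.
- by apply: ht exy; rewrite !inE ?xv ?yv.
Qed.

(* [lev x] counts how often [x] survives the removal of all vertices of degree
   at most [8 * d]; each removal leaves at most a quarter of the vertices. *)
Lemma degenerate_levels : exists lev : V -> nat,
  (forall x, #|[set y | e x y && (lev x <= lev y)%N]| <= 8 * d)%N
  /\ (\sum_x 2 ^ lev x <= 2 * #|V|)%N.
Proof.
suff h (S : {set V}) : exists lev : V -> nat,
    {in S, forall x, #|[set y in S | e x y && (lev x <= lev y)%N]| <= 8 * d}%N
    /\ (\sum_(x in S) 2 ^ lev x <= 2 * #|S|)%N.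
  have [lev [h1 h2]] := h setT; exists lev; split.
    move=> x; apply: leq_trans (h1 x _); rewrite ?inE //.
    by apply: subset_leq_card; apply/subsetP=> y; rewrite !inE.
  by move: h2; rewrite cardsT (eq_bigl xpredT) // => x; rewrite inE.
have [n] := ubnP #|S|; elim: n S => // n IH S Sn.
have [->|S0] := eqVneq S set0.
  by exists (fun=> 0); rewrite big_set0; split=> // x; rewrite inE.
pose T := [set x in S | 8 * d < #|[set u in S | e x u]|]%N.
have TS : T \subset S by apply/subsetP=> x; rewrite inE => /andP[].
have le4 : (4 * #|T| <= #|S|)%N.
  have : ((8 * d).+1 * #|T| <= 2 * d * #|S|)%N.
    apply: leq_trans (degenerate_degree_sum S).
    rewrite mulnC -sum_nat_const [X in (_ <= X)%N](big_setID T) /= (setIidPr TS).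
    by apply: leq_trans (leq_addr _ _); apply: leq_sum => x; rewrite inE => /andP[].
  by have := subset_leq_card TS; case: (d) => [|d']; nia.
have S1 : (0 < #|S|)%N by rewrite card_gt0.
have [|lev [l1 l2]] := IH T; first by lia.
exists (fun x => if x \in T then (lev x).+1 else 0); split.
  move=> x xS; have [xT|xT] := boolP (x \in T).
    apply: leq_trans (l1 x xT); apply: subset_leq_card; apply/subsetP=> y.
    by rewrite [y \in _]inE [y \in [set _ in T | _]]inE; case: (y \in T); rewrite /= ?andbF // => /andP[].
  apply: (@leq_trans #|[set u in S | e x u]|).
    by apply: subset_leq_card; apply/subsetP=> y; rewrite !inE andbT.
  by move: xT; rewrite inE xS /= -leqNgt.
(* Survivors double their weight, so [T] contributes at most [4 * #|T|] and each other vertex 1. By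
   [le4] the total is at most [2 * #|S|]. *)
rewrite (big_setID T) /= (setIidPr TS).
have -> : \sum_(i in S :\: T) 2 ^ (if i \in T then (lev i).+1 else 0) = #|S :\: T|.
  rewrite -sum1_card; apply: eq_bigr => x; rewrite inE => /andP[/negPf -> _].
  by [].
have -> : \sum_(i in T) 2 ^ (if i \in T then (lev i).+1 else 0) = 2 * \sum_(i in T) 2 ^ lev i.
  by rewrite big_distrr; apply: eq_bigr => x ->; rewrite expnS.
have := cardsID T S; rewrite (setIidPr TS); lia.
Qed.

End Degenerate.

(** The Erdos-Rado condition: the colour of a [k.+1]-subset of [s] depends only on its first
    element, through [f]. *)
Fixpoint prehomogeneous (V : finType) (C : Type) (k : nat) (col : {set V} -> C)
    (f : V -> C) (s : seq V) : Prop :=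
  if s is v :: s' then
    (forall h : {set V}, h \subset [set x in s'] -> #|h| = k ->
       col (v |: h) = f v) /\ prehomogeneous k col f s'
  else True.

Lemma prehomogeneous_eq (V : finType) (C : Type) k (col : {set V} -> C) f g s :
  {in s, f =1 g} -> prehomogeneous k col f s -> prehomogeneous k col g s.
Proof.
elim: s => //= v s IH fg [fv /IH h]; split=> [t ts tk|].
  by rewrite fv // fg // mem_head.
by apply: h => x xs; apply: fg; rewrite inE xs orbT.
Qed.

Lemma prehomogeneous_mono (V : finType) (C : eqType) k (col : {set V} -> C)
    (f : V -> C) s c (h : {set V}) :
  prehomogeneous k col f s -> h \subset [set x in s | f x == c] ->
  #|h| = k.+1 -> col h = c.
Proof.
elim: s h => [|v s IH] h /=.
  move=> _ hs; have /eqP-> : h == set0.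
    rewrite -subset0; apply: subset_trans hs _.
    by apply/subsetP=> x; rewrite !inE.
  by rewrite cards0.
case=> fv /IH {}IH hs hk; have [vh|vh] := boolP (v \in h).
  have fvc : f v = c by have := subsetP hs v vh; rewrite !inE => /andP[_ /eqP].
  rewrite -(setD1K vh) -fvc fv //.
    apply/subsetP=> x; rewrite !inE => /andP[xv /(subsetP hs)].
    by rewrite !inE (negPf xv) => /andP[].
  by have := cardsD1 v h; rewrite vh hk => -[].
apply: IH => //; apply/subsetP=> x xh; have := subsetP hs x xh.
by rewrite !inE; case: eqP => // xv; rewrite -xv xh in vh.
Qed.

Lemma exists_subset_card (V : finType) (X : {set V}) m : (m <= #|X|)%N ->
  exists2 A : {set V}, A \subset X & #|A| = m.
Proof.
case/card_geqP=> s [us sm sX]; exists [set x in s].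
  by apply/subsetP=> x; rewrite inE => /sX.
by rewrite -sm -(card_uniqP us); apply: eq_card => x; rewrite inE.
Qed.

Lemma exists_large_fiber (T : eqType) q (f : T -> 'I_q) (s : seq T) m :
  (q * m < size s)%N -> exists c, (m < count [pred x | f x == c] s)%N.
Proof.
move=> lt; apply/existsP; apply: contraTT lt => /existsPn h; rewrite -leqNgt.
have -> : size s = \sum_(c : 'I_q) count [pred x | f x == c] s.
  elim: s {h} => [|x s IH] /=; first by rewrite big1.
  by rewrite big_split /= -IH (bigD1 (f x)) //= eqxx big1 // => c /negPf; rewrite eq_sym => ->.
apply: (@leq_trans (\sum_(c : 'I_q) m)); last by rewrite sum_nat_const card_ord.
by apply: leq_sum => c _; rewrite leqNgt h.
Qed.

(** Induction on the uniformity: the case [k], applied to the links of successively chosen vertices,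
    yields a long [prehomogeneous] sequence, and a frequent value of [f] on it gives the
    monochromatic set. *)
Lemma hypergraph_ramsey k q m :
  exists M, forall (V : finType) (col : {set V} -> 'I_q) (X : {set V}),
    (M <= #|X|)%N -> exists c (A : {set V}),
      [/\ A \subset X, #|A| = m
        & forall h : {set V}, h \subset A -> #|h| = k -> col h = c].
Proof.
elim: k m => [|k IHk] m.
  exists m => V col X /exists_subset_card[A AX Am]; exists (col set0), A.
  by split=> // h _ /eqP; rewrite cards_eq0 => /eqP ->.
have pre l : exists M, forall (V : finType) (col : {set V} -> 'I_q) (X : {set V}),
    (M <= #|X|)%N -> exists s f,
      [/\ uniq s, size s = l, {subset s <= X} & prehomogeneous k col f s].
  elim: l => [|l [M IH]]; first by exists 0 => V col X _; exists [::], (fun=> col set0).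
  have [M' IH'] := IHk M; exists M'.+1 => V col X MX.
  have /card_gt0P[v vX] : (0 < #|X|)%N by apply: leq_trans MX.
  have := cardsD1 v X; rewrite vX => cX.
  have M'X : (M' <= #|X :\ v|)%N by rewrite -ltnS -[X in (_ < X)%N]add1n -cX.
  have [c [A [AX Am Ac]]] := IH' V (fun h => col (v |: h)) _ M'X.
  have [|s [f [us sl sA sp]]] := IH V col A; first by rewrite Am.
  have vs : v \notin s.
    by apply/negP=> /sA /(subsetP AX); rewrite !inE eqxx.
  exists (v :: s), (fun x => if x == v then c else f x).
  split=> /=; rewrite ?vs ?sl //.
    move=> x; rewrite inE => /orP[/eqP -> //|/sA /(subsetP AX)].
    by rewrite inE => /andP[].
  split.
    move=> h hs hk; rewrite eqxx Ac //; apply: subset_trans hs _.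
    by apply/subsetP=> x; rewrite inE => /sA.
  apply: prehomogeneous_eq sp => x xs; case: eqP => // xv.
  by rewrite -xv xs in vs.
have [M HM] := pre (q * m).+1; exists M => V col X MX.
have [s [f [us ss sX sp]]] := HM V col X MX.
have [c mc] : exists c, (m < count [pred x | f x == c] s)%N.
  by apply: exists_large_fiber; rewrite ss.
have [|A As Am] := @exists_subset_card V [set x in s | f x == c] m.
  apply: ltnW; apply: (leq_trans mc); rewrite -size_filter.
  rewrite -(card_uniqP (filter_uniq _ us)); apply: subset_leq_card.
  by apply/subsetP=> x; rewrite mem_filter !inE andbC.
exists c, A; split=> //.
  by apply/subsetP=> x /(subsetP As); rewrite inE => /andP[/sX].
move=> h hA hk; apply: (prehomogeneous_mono sp) hk.
exact: subset_trans hA As.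
Qed.

Local Open Scope ring_scope.

(** * Random labels and dependent random choice *)

Section InverseMoment.
Variables (F : realFieldType) (R L : finType) (p : L -> F).
Hypothesis dp : distr p.

Lemma distr_le1 c : p c <= 1.
Proof.
case: dp => p0 p1; rewrite -p1 (bigD1 c) //= lerDl; exact: sumr_ge0.
Qed.

Lemma prod_indicator (I : finType) (S : {set I}) (P : pred I) :
  \prod_(i in S) (P i)%:R = [forall i in S, P i]%:R :> F.
Proof.
have [/forall_inP h|] := boolP [forall i in S, P i].
  by apply: big1 => i /h ->.
rewrite negb_forall_in => /exists_inP[i iS /negPf Pi].
by rewrite (bigD1 i) //= Pi mul0r.
Qed.

Definition labelled (N : {set R}) c (lam : {ffun R -> L}) : nat :=
  #|[set v in N | lam v == c]|.

Lemma labelled_dep N c : dep_on N (labelled N c).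
Proof.
move=> u v e; apply: eq_card => x; rewrite !inE; have [xN|//] := boolP (x \in N).
by rewrite e.
Qed.

(* With [X] the number of points of [N] labelled [c], [X ^ s] counts the
   [s]-tuples of such points; a fixed tuple is labelled [c] with probability at
   least [p c ^ s] and leaves at most [s] more than the points outside it. *)
Lemma inverse_moment (N : {set R}) c s : (0 < s)%N ->
  (#|N|%:R * p c) ^+ s * Ex p (fun lam => (labelled N c lam + s)%:R ^- s) <= 1.
Proof.
move=> s0; have pc0 : 0 <= p c by case: dp.
pose W (e : {ffun 'I_s -> R}) := [set e i | i : 'I_s].
pose A e (lam : {ffun R -> L}) : F := \prod_(v in W e) (lam v == c)%:R.
have AE e lam : A e lam = [forall v in W e, lam v == c]%:R by exact: prod_indicator.
have Ws e : (#|W e| <= s)%N by apply: leq_trans (leq_imset_card _ _) _; rewrite cardT size_enum_ord.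
have one e : e \in ffun_on (mem N) ->
    p c ^+ s * Ex p (fun lam => (labelled N c lam + s)%:R ^- s)
    <= Ex p (fun lam => A e lam * (labelled N c lam)%:R ^- s).
  move=> /ffun_onP eN; pose Y lam : F := (labelled (N :\: W e) c lam + s)%:R ^- s.
  have expA : Ex p (A e) = p c ^+ #|W e|.
    rewrite (Ex_prod (W e) (fun _ l => (l == c)%:R) dp) -prodr_const.
    apply: eq_bigr => v _; rewrite (bigD1 c) //= eqxx mulr1 big1 ?addr0 // => l.
    by move=> /negPf ->; rewrite mulr0.
  apply: (@le_trans _ _ (Ex p (fun lam => A e lam * Y lam))).
    rewrite (Ex_indep (W := W e) dp); first last.
    - move=> u v h; rewrite /Y (@labelled_dep _ c u v) // => x.
      by rewrite inE => /andP[xW _]; apply: h; rewrite inE.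
    - by move=> u v h; apply: eq_bigr => x xW; rewrite h.
    rewrite expA; apply: ler_pM; rewrite ?exprn_ge0 //.
    - by apply: Ex_ge0 => // lam; rewrite invr_ge0 exprn_ge0.
    - apply: ler_wiXn2l => //; exact: distr_le1.
    apply: Ex_le => // lam; rewrite /Y -!exprVn; apply: lerXn2r; rewrite ?nnegrE ?invr_ge0 //.
    rewrite lef_pV2 ?posrE ?ltr0n ?addn_gt0 ?s0 ?orbT // ler_nat leq_add2r.
    by apply: subset_leq_card; apply/subsetP=> x; rewrite !inE => /andP[/andP[_ ->]].
  apply: Ex_le => // lam; rewrite AE; case: forall_inP => [h|_]; last by rewrite !mul0r.
  rewrite !mul1r /Y -!exprVn; apply: lerXn2r; rewrite ?nnegrE ?invr_ge0 //.
  have X0 : (0 < labelled N c lam)%N.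
    apply/card_gt0P; exists (e (Ordinal s0)); rewrite inE eN h //.
    exact: imset_f.
  rewrite lef_pV2 ?posrE ?ltr0n ?addn_gt0 ?s0 ?orbT // ler_nat.
  apply: leq_trans (leq_add (leqnn _) (Ws e)); rewrite /labelled.
  apply: leq_trans (leq_card_setU _ _); apply: subset_leq_card.
  by apply/subsetP=> x; rewrite !inE => /andP[-> ->]; rewrite !andbT orNb.
apply: (@le_trans _ _ (\sum_(e in ffun_on (mem N))
    Ex p (fun lam => A e lam * (labelled N c lam)%:R ^- s))).
  rewrite exprMn -natrX.
  have <- : #|ffun_on (mem N) : pred {ffun 'I_s -> R}| = (#|N| ^ s)%N.
    by rewrite card_ffun_on card_ord.
  rewrite -mulrA mulr_natl -sumr_const; exact: ler_sum.
rewrite -Ex_sum -[leRHS](Ex_cst R 1 dp); apply: Ex_le => // lam.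
rewrite -mulr_suml.
have -> : \sum_(e in ffun_on (mem N)) A e lam = (labelled N c lam)%:R ^+ s.
  rewrite -natrX; have <- : #|ffun_on (mem [set v in N | lam v == c]) : pred {ffun 'I_s -> R}| = (labelled N c lam ^ s)%N.
    by rewrite card_ffun_on card_ord.
  rewrite -sum1_card natr_sum (bigID (fun e : {ffun 'I_s -> R} => [forall v in W e, lam v == c])) /=.
  rewrite [X in _ + X]big1 ?addr0 => [|e /andP[_ /negPf h]]; last by rewrite AE h.
  apply: eq_big => [e|e /andP[_ h]]; last by rewrite AE h.
  apply/andP/ffun_onP => [[/ffun_onP eN /forall_inP h] i|h].
    by rewrite !inE eN h // imset_f.
  split; first by apply/ffun_onP => i; have := h i; rewrite inE => /andP[].
  by apply/forall_inP => v /imsetP[i _ ->]; have := h i; rewrite inE => /andP[].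
(* If no point of [N] is labelled [c], the product vanishes because [0 ^+ s = 0] for [s > 0];
   otherwise it equals 1. *)
have [->|X0] := posnP (labelled N c lam); first by rewrite expr0n eqn0Ngt s0 mul0r.
by rewrite mulfV // expf_neq0 // pnatr_eq0 -lt0n.
Qed.

Lemma exprD_le (x y : F) s : 0 <= x -> 0 <= y ->
  (x + y) ^+ s <= 2 ^+ s * (x ^+ s + y ^+ s).
Proof.
wlog xy : x y / x <= y => [h x0 y0|x0 y0].
  by have [|/ltW] := leP x y; move/h; [|rewrite addrC [_ ^+ _ + _]addrC]; apply.
apply: (@le_trans _ _ ((2 * y) ^+ s)).
  by apply: lerXn2r; rewrite ?nnegrE ?addr_ge0 ?mulr_ge0 //; lra.
by rewrite exprMn ler_wpM2l ?exprn_ge0 // lerDr exprn_ge0.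
Qed.

(** On the event, the points of [W] have labels other than [c], so deleting them from [N] does not
    change the count and makes it independent of the event. The deletion removes at most [D] points,
    whence the factor [D.+1]; then [inverse_moment] applies. *)
Lemma label_moment (V : finType) (Bx : {set V}) (phi : {ffun V -> R})
    (cl : V -> L) c (N : {set R}) s D :
  (0 < s)%N -> (#|Bx| <= D)%N -> {in Bx &, injective phi} ->
  {in Bx, forall y, cl y != c} ->
  Ex p (fun lam => [forall y in Bx, lam (phi y) == cl y]%:R *
      (1 + 2 * s.+1%:R * (#|R|%:R * p c) / (labelled N c lam + s)%:R) ^+ s)
  <= (\prod_(y in Bx) p (cl y)) *
     (2 ^+ s * (1 + (2 * s.+1%:R * D.+1%:R) ^+ s
        * (#|R|%:R / (maxn 1 #|N|)%:R) ^+ s)).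
Proof.
move=> s0 BD phi_inj clc; have pc0 : 0 <= p c by case: dp.
pose W := phi @: Bx; pose N' := N :\: W.
pose A (lam : {ffun R -> L}) : F := [forall y in Bx, lam (phi y) == cl y]%:R.
pose k : F := 2 * s.+1%:R * #|R|%:R.
pose h (lam : {ffun R -> L}) : F :=
  2 ^+ s * (1 + (k * p c) ^+ s * (labelled N' c lam + s)%:R ^- s).
have k0 : 0 <= k by rewrite !mulr_ge0.
apply: (@le_trans _ _ (Ex p (fun lam => A lam * h lam))).
  apply: Ex_le => // lam; rewrite /A; case: forall_inP => [e|_]; last by rewrite !mul0r.
  rewrite !mul1r /h.
  have -> : labelled N c lam = labelled N' c lam.
    apply: eq_card => v; rewrite !inE; case: eqP => [vc|]; last by rewrite !andbF.
    rewrite !andbT; have [/imsetP[y yB vy]|//] := boolP (v \in W).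
    by have := clc y yB; rewrite -(eqP (e y yB)) -vy vc eqxx.
  apply: le_trans (exprD_le _ _ _) _ => //.
    by rewrite divr_ge0 // !mulr_ge0.
  by rewrite expr1n exprMn mulrA exprVn.
have AP lam : A lam = \prod_(v in W) \prod_(y in Bx | phi y == v) (lam v == cl y)%:R.
  rewrite /A -prod_indicator (partition_big_imset phi) /=.
  by apply: eq_bigr => v _; apply: eq_bigr => y /andP[_ /eqP ->].
have EA : Ex p A = \prod_(y in Bx) p (cl y).
  rewrite (eq_Ex p AP) (Ex_prod W (fun v l => \prod_(y in Bx | phi y == v) (l == cl y)%:R) dp).
  rewrite big_imset //=; apply: eq_bigr => y yB.
  rewrite (bigD1 (cl y)) //= [X in _ + X]big1 ?addr0.
    rewrite big1 ?mulr1 // => z /andP[zB /eqP zy].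
    by rewrite (phi_inj z y zB yB zy) eqxx.
  move=> l /negPf ly; rewrite (bigD1 y) /= ?yB ?eqxx //.
  by rewrite ly mul0r mulr0.
rewrite (Ex_indep (W := W) dp); first last.
- move=> u v e; rewrite /h (@labelled_dep _ c u v) // => x.
  by rewrite inE => /andP[xW _]; apply: e; rewrite inE.
- move=> u v e; rewrite /A; congr (_%:R); congr nat_of_bool.
  apply: eq_forallb => y; have [yB|//] := boolP (y \in Bx).
  by rewrite e // imset_f.
rewrite EA; apply: ler_wpM2l; first by apply: prodr_ge0 => y _; case: dp.
rewrite /h ExZ ExD (Ex_cst _ _ dp) ExZ; apply: ler_wpM2l; first exact: exprn_ge0.
rewrite lerD2l.
set E := Ex p _; have E0 : 0 <= E.
  by apply: Ex_ge0 => // lam; rewrite invr_ge0 exprn_ge0.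
set n' : F := (maxn 1 #|N'|)%:R; have n'0 : 0 < n' by rewrite ltr0n leq_max.
have le1 : p c ^+ s * E <= n' ^- s.
  rewrite -[leRHS]mul1r ler_pdivlMr ?exprn_gt0 //.
  have [N0|N0] := posnP #|N'|; last first.
    have := inverse_moment N' c s0; rewrite -/E /n' (maxn_idPr N0) exprMn => h1.
    by rewrite mulrAC [X in X * _]mulrC.
  rewrite /n' N0 maxn0 expr1n mulr1.
  apply: mulr_ile1; rewrite ?exprn_ge0 //; first exact: exprn_ile1 (distr_le1 c).
  rewrite -[leRHS](Ex_cst R 1 dp); apply: Ex_le => // lam; rewrite -exprVn exprn_ile1 ?invr_ge0 //.
  by rewrite invf_le1 ?ler1n ?ltr0n addn_gt0 s0 orbT.
have le2 : (maxn 1 #|N|)%:R <= D.+1%:R * n'.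
  rewrite -natrM ler_nat.
  have : (#|N| <= #|N'| + D)%N.
    rewrite -(cardsID W N) addnC leq_add2l.
    apply: leq_trans (subset_leq_card (subsetIr _ _)) _.
    exact: leq_trans (leq_imset_card _ _) BD.
  by nia.
rewrite [X in X * E]exprMn -[leLHS]mulrA.
have -> : (2 * s.+1%:R * D.+1%:R) ^+ s * (#|R|%:R / (maxn 1 #|N|)%:R) ^+ s
   = k ^+ s * (D.+1%:R / (maxn 1 #|N|)%:R) ^+ s.
  rewrite -!exprMn; congr (_ ^+ _); rewrite /k; ring.
apply: ler_wpM2l; first exact: exprn_ge0.
apply: (le_trans le1); rewrite -exprVn; apply: lerXn2r.
- by rewrite nnegrE invr_ge0 ltW.
- by rewrite nnegrE divr_ge0.
rewrite ler_pdivlMr ?ltr0n ?leq_max // mulrC ler_pdivrMr //.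
Qed.

End InverseMoment.

Section Dependent.
Variables (F : realFieldType) (R : finType).
Hypothesis R_gt0 : (0 < #|R|)%N.

(** Once the coordinates outside [W] are fixed, so is [N g], and each coordinate in [W] falls into
    it with probability [#|N g| / #|R|], which cancels one factor of the inverse size. The [maxn 1]
    keeps the quotient meaningful for an empty set. *)
Lemma dependent_random_choice (J : finType) (W : {set J})
    (N : {ffun J -> R} -> {set R}) :
  dep_on (~: W) N ->
  Ex (unif F (R := R)) (fun g => [forall j in W, g j \in N g]%:R *
     (#|R|%:R / (maxn 1 #|N g|)%:R) ^+ #|W|) <= 1.
Proof.
move=> dN; have dU := unif_distr F R_gt0.
rewrite -(Ex_glue W _ dU) -[leRHS](Ex_cst J 1 dU); apply: Ex_le => // g.
have R0 : (0 : F) < #|R|%:R by rewrite ltr0n.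
set m := maxn 1 #|N g|; have m0 : (0 : F) < m%:R by rewrite ltr0n leq_max.
rewrite (@eq_Ex _ _ _ _ _ (fun h => (\prod_(j in W) (h j \in N g)%:R) *
   (#|R|%:R / m%:R) ^+ #|W|)).
  rewrite ExZr (Ex_prod W (fun _ v => (v \in N g)%:R) dU) prodr_const -exprMn.
  have e : \sum_l unif F l * (l \in N g)%:R = #|N g|%:R / #|R|%:R.
    rewrite -mulr_sumr mulrC; congr (_ / _); rewrite -sum1_card natr_sum [RHS]big_mkcond.
    by apply: eq_bigr => v _; case: (v \in N g).
  rewrite e; have -> : #|N g|%:R / #|R|%:R * (#|R|%:R / m%:R) = #|N g|%:R / m%:R :> F.
    by field; rewrite !gt_eqF.
  rewrite exprn_ile1 ?divr_ge0 // ler_pdivrMr // mul1r ler_nat.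
  by rewrite leq_max leqnn orbT.
move=> h; have -> : N (glue W g h) = N g.
  by apply: dN => j; rewrite inE ffunE => /negPf ->.
congr (_ * _); rewrite prod_indicator; congr (_%:R); congr nat_of_bool.
apply: eq_forallb => j; have [jW|//] := boolP (j \in W).
by rewrite ffunE jW.
Qed.

Lemma Ex_collision (J : finType) (i j : J) : i != j ->
  Ex (unif F (R := R)) (fun g => (g i == g j)%:R) = #|R|%:R^-1.
Proof.
move=> ij; have dU := unif_distr F R_gt0.
rewrite -(Ex_glue [set i] _ dU) -[RHS](Ex_cst J _ dU); apply: eq_Ex => g.
rewrite (@eq_Ex _ _ _ _ _ (fun h => (h i == g j)%:R)).
  rewrite (Ex_coord i (fun v => (v == g j)%:R) dU) (bigD1 (g j)) //= eqxx mulr1.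
  by rewrite big1 ?addr0 // => v /negPf ->; rewrite mulr0.
by move=> h; rewrite !ffunE !inE eqxx [j == i]eq_sym (negPf ij).
Qed.

End Dependent.

Definition clique_in (I J R : finType) (C : eqType) k (col : {set R} -> C) (c : C)
    (iota : I -> J) (g : {ffun J -> R}) : bool :=
  [forall h : {set I}, (#|h| == k) ==>
    ((#|[set g (iota i) | i in h]| == k) && (col [set g (iota i) | i in h] == c))].

(** A uniform sample of [M] vertices has no repetition with probability over one half, since at most
    [M ^ 2 / #|R|] collisions are expected. Ramsey's theorem then finds a clique in it, and
    pigeonhole fixes its colour and its position [iota] at a cost independent of [R]. *)
Lemma random_monochromatic_clique (F : realFieldType) k q (I : finType) :
  exists (M : nat) (rho : F), 0 < rho /\
    forall (R : finType) (col : {set R} -> 'I_q), (2 * M ^ 2 < #|R|)%N ->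
    exists (c : 'I_q) (iota : {ffun I -> 'I_M}), injective iota /\
      rho <= Ex (unif F (R := R)) (fun g => (clique_in k col c iota g)%:R).
Proof.
have [M HM] := hypergraph_ramsey k q #|I|.
pose T := ('I_q * {ffun I -> 'I_M})%type.
(* One half is shared among the pairs of a colour and a position; the successor keeps the bound
   positive even if [T] is empty. *)
exists M, (2 * #|{: T}|.+1%:R)^-1; split; first by rewrite invr_gt0 mulr_gt0.
move=> R col RM; have R0 : (0 < #|R|)%N by apply: leq_ltn_trans RM.
have dU := unif_distr F R0.
pose z (t : T) := Ex (unif F (R := R)) (fun g => (clique_in k col t.1 t.2 g)%:R).
suff [t /andP[ti tz]] : exists t : T, injectiveb t.2 && ((2 * #|{: T}|.+1%:R)^-1 <= z t).
  by exists t.1, t.2; split=> //; apply/injectiveP.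
have cover (g : {ffun 'I_M -> R}) : (1 : F) <=
    \sum_(t : T | injectiveb t.2) (clique_in k col t.1 t.2 g)%:R
    + \sum_(ij : 'I_M * 'I_M | ij.1 != ij.2) (g ij.1 == g ij.2)%:R.
  have [/injectiveP gi|/injectivePn[i [j ij gij]]] := boolP (injectiveb g); last first.
    rewrite addrC (bigD1 (i, j)) //= gij eqxx -addrA lerDl addr_ge0 ?sumr_ge0 //.
  have [|c [A [Ag Am Ac]]] := HM R col (g @: setT).
    by rewrite card_imset // cardsT card_ord.
  pose A' := g @^-1: A; have gA' : g @: A' = A.
    apply/setP=> v; apply/imsetP/idP => [[j jA ->]|vA]; first by move: jA; rewrite inE.
    by have /imsetP[j _ vj] := subsetP Ag v vA; exists j; rewrite // inE -vj.
  have eI : #|I| = #|A'| by rewrite -Am -gA' card_imset.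
  pose iota := [ffun i : I => enum_val (cast_ord eI (enum_rank i))].
  have iota_inj : injective iota.
    by move=> i j; rewrite !ffunE => /enum_val_inj /cast_ord_inj /enum_rank_inj.
  rewrite (bigD1 (c, iota)) /=; last exact/injectiveP.
  suff -> : clique_in k col c iota g by rewrite -addrA lerDl addr_ge0 ?sumr_ge0.
  apply/forallP=> h; apply/implyP=> /eqP hk.
  have hk' : #|[set g (iota i) | i in h]| = k.
    by rewrite card_imset // => i j /gi /iota_inj.
  rewrite hk' eqxx /=; apply/eqP; apply: Ac => //.
  apply/subsetP=> v /imsetP[i _ ->]; have := enum_valP (cast_ord eI (enum_rank i)).
  by rewrite inE ffunE.
have half : 2^-1 < \sum_(t : T | injectiveb t.2) z t.
  have : (1 : F) <= \sum_(t : T | injectiveb t.2) z t + (M ^ 2)%:R / #|R|%:R.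
    rewrite -[leLHS](Ex_cst (ordinal M) 1 dU); apply: le_trans (Ex_le dU cover) _.
    rewrite ExD !Ex_sum lerD2l.
    apply: (@le_trans _ _ (\sum_(ij : 'I_M * 'I_M | ij.1 != ij.2) #|R|%:R^-1)).
      by apply: ler_sum => ij ne; rewrite Ex_collision.
    rewrite sumr_const -[_ *+ _]mulr_natl ler_wpM2r ?invr_ge0 // ler_nat.
    by apply: leq_trans (max_card _) _; rewrite card_prod card_ord.
  have : (M ^ 2)%:R / #|R|%:R < 2^-1 :> F.
    rewrite ltr_pdivrMr ?ltr0n //.
    by move: RM; rewrite -(ltr_nat F) natrM; lra.
  lra.
apply/existsP; apply: contraTT half => /existsPn h; rewrite -leNgt.
apply: (@le_trans _ _ (\sum_(t : T | injectiveb t.2) (2 * #|{: T}|.+1%:R)^-1)).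
  apply: ler_sum => t ti; have := h t; rewrite ti /= -ltNge; exact: ltW.
rewrite sumr_const -[_ *+ _]mulr_natl invfM mulrCA.
rewrite -[leRHS]mulr1 ler_wpM2l ?invr_ge0 // ler_pdivrMr ?ltr0n // mul1r ler_nat.
by apply: leq_trans (max_card _) _.
Qed.

(** * Embedding around a random clique *)

Lemma Ex_swap (F : realFieldType) (I L I' L' : finType) (p : L -> F) (p' : L' -> F)
    (f : {ffun I -> L} -> {ffun I' -> L'} -> F) :
  Ex p (fun u => Ex p' (f u)) = Ex p' (fun v => Ex p (f^~ v)).
Proof.
rewrite /Ex; under eq_bigr do rewrite mulr_sumr.
rewrite exchange_big; apply: eq_bigr => v _; rewrite mulr_sumr.
by apply: eq_bigr => u _; ring.
Qed.

Section CliqueEmbedding.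
Variables (V R J C : finType) (k r t : nat) (col : {set R} -> C) (chi : C).
Variables (E : {set {set V}}) (tau : V -> 'I_r) (ord : V -> nat).
Variable iota : 'I_r * 'I_t -> J.
Hypothesis iota_inj : injective iota.
Hypothesis tau_inj : forall h, h \in E -> {in h &, injective tau}.
Hypothesis ord_inj : forall h, h \in E -> {in h &, injective ord}.
Implicit Types (g : {ffun J -> R}) (S : {set V}) (phi : {ffun V -> R}).

Definition earlier x : {set V} :=
  [set y | (ord y < ord x)%N && [exists h in E, (x \in h) && (y \in h)]].

(* The image of [S] can be completed to an edge of colour [chi] by any sampled
   vertices whose types differ from those of [S]. *)
Definition good g S phi : bool :=
  [forall P : {set 'I_r * 'I_t},
    (#|S| + #|P| == k)%N && [disjoint [set i.1 | i in P] & tau @: S] ==>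
    ((#|phi @: S :|: [set g (iota i) | i in P]| == k) &&
     (col (phi @: S :|: [set g (iota i) | i in P]) == chi))].

Definition nbr g x phi : {set R} :=
  [set v | [forall h in E, (x \in h) ==> [forall S : {set V},
     (S \subset h :&: earlier x) ==> good g (x |: S) (upd phi x v)]]].

(** What [nbr] demands of the earlier images with [x] left out; this is the hypothesis under which
    the sampled block of the type of [x] consists of candidates. *)
Definition admissible g x phi : bool :=
  [forall h in E, (x \in h) ==> [forall S : {set V},
     (S \subset h :&: earlier x) ==> good g S phi]].

Definition type_sample x : {set J} := [set iota (tau x, j) | j : 'I_t].

Lemma nbrP g x phi v :
  reflect (forall h S, h \in E -> x \in h -> S \subset h :&: earlier x ->
             good g (x |: S) (upd phi x v))
          (v \in nbr g x phi).
Proof.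
rewrite inE; apply: (iffP forall_inP) => [H h S hE xh SB|H h hE].
  by have /implyP/(_ xh)/forallP/(_ S)/implyP := H h hE; apply.
apply/implyP=> xh; apply/forallP=> S; apply/implyP; exact: H.
Qed.

Lemma admissibleP g x phi :
  reflect (forall h S, h \in E -> x \in h -> S \subset h :&: earlier x ->
             good g S phi)
          (admissible g x phi).
Proof.
apply: (iffP forall_inP) => [H h S hE xh SB|H h hE].
  by have /implyP/(_ xh)/forallP/(_ S)/implyP := H h hE; apply.
apply/implyP=> xh; apply/forallP=> S; apply/implyP; exact: H.
Qed.

Lemma good_dep g S : dep_on S (good g S).
Proof.
move=> u v e; apply: eq_forallb => P; have -> // : u @: S = v @: S.
exact: eq_in_imset.
Qed.

Lemma earlier_irr x : x \notin earlier x.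
Proof. by rewrite inE ltnn. Qed.

Lemma nbr_dep g x : dep_on (earlier x) (nbr g x).
Proof.
move=> u v e; apply/setP=> y.
have gE (h S : {set V}) : S \subset h :&: earlier x ->
    good g (x |: S) (upd u x y) = good g (x |: S) (upd v x y).
  move=> SB; apply: good_dep => i; rewrite !inE !ffunE; case: eqP => //= _ iS.
  by rewrite e //; have := subsetP SB i iS; rewrite inE => /andP[].
by apply/nbrP/nbrP => H h S hE xh SB; have := H h S hE xh SB; rewrite (gE h).
Qed.

Lemma admissible_dep g x : dep_on (earlier x) (admissible g x).
Proof.
move=> u v e.
have gE (h S : {set V}) : S \subset h :&: earlier x -> good g S u = good g S v.
  move=> SB; apply: good_dep => i iS; rewrite e //.
  by have := subsetP SB i iS; rewrite inE => /andP[].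
by apply/admissibleP/admissibleP => H h S hE xh SB; have := H h S hE xh SB;
  rewrite (gE h).
Qed.

(** In [good g (x |: S)] the sampled vertices have types other than [tau x], so the block of that
    type is never read. This is the independence needed for [dependent_random_choice]. *)
Lemma nbr_sample_dep x phi : dep_on (~: type_sample x) (fun g => nbr g x phi).
Proof.
move=> g g' e; apply/setP=> y.
have goodE S : good g (x |: S) (upd phi x y) = good g' (x |: S) (upd phi x y).
  apply: eq_forallb => P; case: andP => //= -[_ dP].
  have -> // : [set g (iota i) | i in P] = [set g' (iota i) | i in P].
  apply: eq_in_imset => i iP; apply: e; rewrite inE; apply/imsetP=> -[j _ /iota_inj ij].
  have := disjointFl dP (imset_f tau (setU11 x S)).
  by move/negP; apply; apply/imsetP; exists i => //; rewrite ij.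
by apply/nbrP/nbrP => H h S hE xh SB; have := H h S hE xh SB; rewrite goodE.
Qed.

(** Putting a sampled vertex of type [tau x] in the place of [x] turns the condition for [x |: S]
    and [P] into that for [S] and [P] with one more index. Types are distinct within an edge, so the
    enlarged [P] still avoids the types of [S]. *)
Lemma sample_in_nbr g x phi : admissible g x phi ->
  {in type_sample x, forall j, g j \in nbr g x phi}.
Proof.
move/admissibleP=> adm _ /imsetP[j _ ->]; apply/nbrP => h S hE xh SB.
have xS : x \notin S.
  by apply/negP=> /(subsetP SB); rewrite inE (negPf (earlier_irr x)) andbF.
apply/forallP=> P; apply/implyP=> /andP[cP dP].
have txP : (tau x, j) \notin P.
  apply/negP=> iP; have := disjointFl dP (imset_f tau (setU11 x S)).
  by move/negP; apply; apply/imsetP; exists (tau x, j).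
have /forallP/(_ ((tau x, j) |: P))/implyP := adm h S hE xh SB.
have -> : phi @: S :|: [set g (iota i) | i in (tau x, j) |: P]
  = upd phi x (g (iota (tau x, j))) @: (x |: S) :|: [set g (iota i) | i in P].
  rewrite !imsetU1 ffunE eqxx setUCA setUA; congr (_ :|: _); congr (_ :|: _).
  apply: eq_in_imset => y yS; rewrite ffunE; case: eqP => // yx.
  by rewrite -yx yS in xS.
apply; apply/andP; split.
  by rewrite cardsU1 txP; move: cP; rewrite cardsU1 xS; lia.
rewrite imsetU1 disjoints_subset subUset; apply/andP; split.
  rewrite sub1set inE; apply/imsetP=> -[y yS txy].
  have yh : y \in h by have := subsetP SB y yS; rewrite inE => /andP[].
  by rewrite (tau_inj hE xh yh txy) yS in xS.
rewrite -disjoints_subset; apply: disjointWr dP; rewrite imsetU1; exact: subsetUr.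
Qed.

(** The condition was imposed when the last vertex of [S] in the order [ord] was embedded, since all
    others are earlier neighbours of it. *)
Lemma good_embedded g phi h S : h \in E -> S \subset h -> S != set0 ->
  {in S, forall y, phi y \in nbr g y phi} -> good g S phi.
Proof.
move=> hE Sh /set0Pn[y0 y0S] H.
have [y yS ymax0] := arg_maxnP ord y0S.
have ymax i : i \in S -> (ord i <= ord y)%N by exact: ymax0.
have yh := subsetP Sh y yS.
have SyB : S :\ y \subset h :&: earlier y.
  apply/subsetP=> z; rewrite !inE => /andP[zy zS]; have zh := subsetP Sh z zS.
  rewrite zh ltn_neqAle ymax //=; apply/andP; split.
    by rewrite andbT; apply: contraNneq zy => /(ord_inj hE zh yh) ->.
  by apply/exists_inP; exists h; rewrite ?yh ?zh.
have /nbrP/(_ h (S :\ y) hE yh SyB) := H y yS.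
rewrite setD1K // (_ : upd phi y (phi y) = phi) //.
by apply/ffunP=> i; rewrite ffunE; case: eqP => [->|].
Qed.

(** For empty [S] the condition follows from the sampled clique; for nonempty [S] it is
    [good_embedded]. *)
Lemma admissible_embedded g x phi : clique_in k col chi iota g ->
  {in earlier x, forall y, phi y \in nbr g y phi} -> admissible g x phi.
Proof.
move=> cg H; apply/admissibleP=> h S hE xh SB.
have [->|S0] := eqVneq S set0.
  apply/forallP=> P; apply/implyP=> /andP[]; rewrite cards0 add0n => kP _.
  by rewrite imset0 set0U; have /forallP/(_ P)/implyP := cg; apply.
apply: (good_embedded hE) => // [|y yS].
  by apply: subset_trans SB (subsetIl _ _).
by apply: H; have := subsetP SB y yS; rewrite inE => /andP[].
Qed.

Lemma embedded_edge g phi h : h \in E -> #|h| = k -> (0 < k)%N ->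
  (forall y, phi y \in nbr g y phi) -> col (phi @: h) = chi.
Proof.
move=> hE hk k0 H; have h0 : h != set0 by rewrite -card_gt0 hk.
have /forallP/(_ set0) := good_embedded hE (subxx h) h0 (fun y _ => H y).
rewrite cards0 addn0 hk eqxx !imset0 disjoints_subset sub0set setU0 /=.
by case/andP=> _ /eqP.
Qed.

(** * Moment bounds for random samples and labels *)

Section Probability.
Variables (F : realFieldType) (L : finType) (cl : V -> L) (p : L -> F) (D : nat) (rho : F).
Hypothesis R_gt0 : (0 < #|R|)%N.
Hypothesis D_gt0 : (0 < D)%N.
Hypothesis tD : t = (2 * D)%N.
Hypothesis dp : distr p.
Hypothesis p_gt0 : forall x, 0 < p (cl x).
Hypothesis cl_ord : forall x y, cl x = cl y -> ord x = ord y.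
Hypothesis earlier_card : forall x, (#|earlier x| <= D)%N.
Hypothesis rho_gt0 : 0 < rho.
Hypothesis clique_prob :
  rho <= Ex (unif F (R := R)) (fun g => (clique_in k col chi iota g)%:R).

Let dU := unif_distr F R_gt0.
Let z := Ex (unif F (R := R)) (fun g => (clique_in k col chi iota g)%:R).
Let Om : finType := ({ffun J -> R} * {ffun R -> L})%type.
Let a x : F := #|R|%:R * p (cl x).

(** The product law of samples and labels, conditioned on the sample containing the clique. *)
Let w (om : Om) : F :=
  z^-1 * ((\prod_j unif F (om.1 j)) * (clique_in k col chi iota om.1)%:R
          * (\prod_v p (om.2 v))).

Let cand (om : Om) x phi : {set R} := [set v in nbr om.1 x phi | om.2 v == cl x].

Let valid (om : Om) x phi : bool :=
  [&& admissible om.1 x phi, [forall y in earlier x, om.2 (phi y) == cl y]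
    & dinjectiveb phi (mem (earlier x))].

Let z_gt0 : 0 < z. Proof. exact: lt_le_trans rho_gt0 clique_prob. Qed.

Let w_sumE f : \sum_om w om * f om =
  z^-1 * Ex (unif F (R := R)) (fun g => (clique_in k col chi iota g)%:R *
    Ex p (fun lam => f (g, lam))).
Proof.
transitivity (\sum_(g : {ffun J -> R}) \sum_(lam : {ffun R -> L})
    w (g, lam) * f (g, lam)).
  by rewrite pair_bigA; apply: eq_bigr => -[].
rewrite mulr_sumr.
apply: eq_bigr => g _; rewrite /Ex !mulr_sumr; apply: eq_bigr => lam _ /=.
by rewrite /w /=; ring.
Qed.

Let w_ge0 om : 0 <= w om.
Proof.
have [u0 _] := dU; have [p0 _] := dp.
by rewrite /w !mulr_ge0 ?invr_ge0 ?prodr_ge0 // ltW.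
Qed.

Let w_sum : \sum_om w om = 1.
Proof.
rewrite (eq_bigr (fun om => w om * 1)) => [|om _]; last by rewrite mulr1.
rewrite (w_sumE (fun=> 1)); under eq_Ex do rewrite (Ex_cst _ _ dp) mulr1.
by rewrite mulVf // gt_eqF.
Qed.

Let K1 : F := 2 ^+ (2 * D) * (1 + (2 * (2 * D).+1%:R * D.+1%:R) ^+ (2 * D)).
(** Division by [rho] pays for the conditioning in [w]. *)
Definition moment_bound : F := K1 / rho.
Local Notation K := moment_bound.

Let type_sample_card x : #|type_sample x| = (2 * D)%N.
Proof. by rewrite card_imset ?card_ord // => i j /iota_inj [->]. Qed.

Let earlier_cl x : {in earlier x, forall y, cl y != cl x}.
Proof.
move=> y; rewrite inE => /andP[yx _].
by apply: contraTneq yx => /cl_ord ->; rewrite ltnn.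
Qed.

Let dlt om := delta a (2 * D) (cand om).

Let dlt_ge0 om x phi : 0 <= dlt om x phi ^+ (2 * D).
Proof.
rewrite exprn_ge0 // addr_ge0 // divr_ge0 // !mulr_ge0 //.
exact: ltW (p_gt0 x).
Qed.

(** Labels are averaged first, by [label_moment], and samples second. Validity puts all [2 * D]
    samples of the type of [x] into [nbr g x phi], so [dependent_random_choice] controls exactly the
    power [2 * D] of the inverse relative size. *)
Let local_moment x phi :
  Ex (unif F (R := R)) (fun g => Ex p (fun lam =>
    (valid (g, lam) x phi)%:R * dlt (g, lam) x phi ^+ (2 * D)))
  <= (\prod_(y in earlier x) p (cl y)) * K1.
Proof.
have P0 : 0 <= \prod_(y in earlier x) p (cl y).
  by apply: prodr_ge0 => y _; exact: ltW.
have s0 : (0 < 2 * D)%N by rewrite muln_gt0.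
set c : F := 2 * (2 * D).+1%:R * D.+1%:R.
have c0 : 0 <= c ^+ (2 * D) by rewrite exprn_ge0 // !mulr_ge0.
have [/dinjectiveP inj|ninj] := boolP (dinjectiveb phi (mem (earlier x))); last first.
  under eq_Ex do under eq_Ex do rewrite /valid (negPf ninj) !andbF mul0r.
  under eq_Ex do rewrite (Ex_cst _ _ dp).
  by rewrite (Ex_cst _ _ dU) mulr_ge0 // mulr_ge0 ?exprn_ge0 // addr_ge0.
pose N g := nbr g x phi.
apply: (@le_trans _ _ (Ex (unif F (R := R)) (fun g =>
   (\prod_(y in earlier x) p (cl y)) * 2 ^+ (2 * D) * (1 + c ^+ (2 * D) *
    ([forall j in type_sample x, g j \in N g]%:R *
     (#|R|%:R / (maxn 1 #|N g|)%:R) ^+ #|type_sample x|))))).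
  apply: Ex_le => // g.
  have [ad|/negPf nad] := boolP (admissible g x phi); last first.
    under eq_Ex do rewrite /valid nad mul0r.
    rewrite (Ex_cst _ _ dp) !mulr_ge0 ?exprn_ge0 // addr_ge0 // !mulr_ge0 //.
    by rewrite exprn_ge0 // divr_ge0.
  have -> : [forall j in type_sample x, g j \in N g].
    by apply/forall_inP; exact: sample_in_nbr.
  rewrite mul1r type_sample_card -mulrA.
  apply: le_trans (label_moment dp (N g) s0 (earlier_card x) inj (@earlier_cl x)).
  apply: Ex_le => // lam; rewrite /valid ad /=.
  have -> : dinjectiveb phi (mem (earlier x)) by apply/dinjectiveP.
  by rewrite andbT.
rewrite ExZ ExD ExZ (Ex_cst _ _ dU) -mulrA; apply: ler_wpM2l => //.
rewrite /K1 -/c ler_wpM2l ?exprn_ge0 // lerD2l -[leRHS]mulr1 ler_wpM2l //.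
exact: (dependent_random_choice F R_gt0 (@nbr_sample_dep x phi)).
Qed.

(** Dropping the clique event and exchanging expectations reduces to [local_moment] for fixed [phi];
    the probabilities [p (cl y)] of the labels cancel the factors [#|R| / a y]. *)
Let moment x :
  \sum_om w om * ((\prod_(y in earlier x) (#|R|%:R / a y)) *
    Ex (unif F (R := R)) (fun phi => (valid om x phi)%:R * dlt om x phi ^+ (2 * D)))
  <= K.
Proof.
have R0 : (0 : F) < #|R|%:R by rewrite ltr0n.
rewrite w_sumE /K mulrC; set Pi := \prod_(y in earlier x) _.
have Pi0 : 0 <= Pi.
  by apply: prodr_ge0 => y _; rewrite divr_ge0 // mulr_ge0 // ltW.
have K10 : 0 <= K1.
  by rewrite mulr_ge0 ?exprn_ge0 // addr_ge0 // exprn_ge0 // !mulr_ge0.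
apply: ler_pM.
- apply: Ex_ge0 => // g; rewrite mulr_ge0 // Ex_ge0 // => lam.
  by rewrite mulr_ge0 // Ex_ge0 // => phi; rewrite mulr_ge0.
- by rewrite invr_ge0 ltW.
- apply: (@le_trans _ _ (Ex (unif F (R := R)) (fun g => Ex p (fun lam => Pi *
     Ex (unif F (R := R)) (fun phi => (valid (g, lam) x phi)%:R *
         dlt (g, lam) x phi ^+ (2 * D)))))).
    apply: Ex_le => // g; case: clique_in; rewrite ?mul1r // mul0r.
    apply: Ex_ge0 => // lam; rewrite mulr_ge0 // Ex_ge0 // => phi.
    by rewrite mulr_ge0.
  under eq_Ex do rewrite ExZ Ex_swap.
  rewrite ExZ Ex_swap.
  apply: (@le_trans _ _ (Pi * Ex (unif F (R := R)) (fun phi : {ffun V -> R} =>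
      (\prod_(y in earlier x) p (cl y)) * K1))).
    apply: ler_wpM2l => //; apply: Ex_le => // phi; exact: local_moment.
  rewrite (Ex_cst _ _ dU) mulrA -big_split /= big1 ?mul1r // => y _.
  by rewrite /a; field; rewrite !gt_eqF ?p_gt0.
- by rewrite lef_pV2 // posrE.
Qed.

Lemma random_clique_embedding : (0 < k)%N -> (forall h, h \in E -> #|h| = k) ->
  \sum_x D.+1%:R * moment_bound / (#|R|%:R * p (cl x)) < 1 ->
  exists phi : {ffun V -> R}, injective phi /\
    forall h, h \in E -> col (phi @: h) = chi.
Proof.
move=> k0 Ek lt1; have /card_gt0P[v0 _] := R_gt0.
have K_ge1 : 1 <= K.
  rewrite /K ler_pdivlMr // mul1r.
  apply: (@le_trans _ _ 1).
    apply: (le_trans clique_prob); rewrite -[leRHS](Ex_cst J 1 dU).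
    by apply: Ex_le => // g; case: clique_in.
  rewrite -[leLHS]mulr1 ler_pM //; first by rewrite exprn_ege1 // ler1n.
  by rewrite lerDl exprn_ge0 // !mulr_ge0.
have early x y : y \in earlier x -> (ord y < ord x)%N by rewrite inE => /andP[].
have a_gt0 x : 0 < a x by rewrite mulr_gt0 // ltr0n.
have cand_dep om x : dep_on (earlier x) (cand om x).
  by move=> u v e; rewrite /cand (nbr_dep om.1 e).
(* A target vertex has a single label, and by [cl_ord] the label determines the layer. *)
have cand_disj (om : Om) x y (u v : {ffun V -> R}) l :
    l \in cand om x u -> l \in cand om y v -> ord x = ord y.
  rewrite !inE => /andP[_ /eqP lx] /andP[_ /eqP ly].
  by apply: cl_ord; rewrite -lx.
have valid_dep om x : dep_on (earlier x) (valid om x).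
  move=> u v e; rewrite /valid (admissible_dep om.1 e); congr (_ && (_ && _)).
    apply: eq_forallb => y; have [yB|//] := boolP (y \in earlier x).
    by rewrite e.
  apply/dinjectiveP/dinjectiveP => H y y' yB y'B.
    by rewrite -!e //; apply: H.
  by rewrite !e //; apply: H.
have valid_cand om x (phi : {ffun V -> R}) : 0 < w om ->
    {in earlier x, forall y, phi y \in cand om y phi} ->
    {in earlier x &, injective phi} -> valid om x phi.
  move=> w0 H inj; rewrite /valid; apply/and3P; split.
  - apply: admissible_embedded; last by move=> y /H; rewrite inE => /andP[].
    by apply: contraTT w0 => /negPf cf; rewrite /w cf mulr0 mul0r mulr0 ltxx.
  - by apply/forall_inP=> y /H; rewrite inE => /andP[].
  - by apply/dinjectiveP.
have [om [phi [_ phi_inj Hphi]]] := random_greedy_embedding D_gt0 R_gt0 early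
  earlier_card a_gt0 cand_dep cand_disj valid_dep valid_cand w_ge0 w_sum K_ge1
  moment [ffun=> v0] lt1.
exists phi; split=> // h hE; apply: (@embedded_edge om.1) => //; first exact: Ek.
by move=> y; have := Hphi y; rewrite inE => /andP[].
Qed.

End Probability.
End CliqueEmbedding.

(** * The Ramsey number *)

(** The weights [2 ^- l.+1 / r.+1] sum to less than 1, so normalising them can only increase
    them. *)
Lemma geometric_label_distr (F : realFieldType) m r :
  exists p : 'I_m.+1 * 'I_r.+1 -> F, distr p /\
    forall c : 'I_m.+1 * 'I_r.+1, (2 ^ c.1.+1 * r.+1)%:R^-1 <= p c.
Proof.
pose w (c : 'I_m.+1 * 'I_r.+1) : F := (2 ^ c.1.+1 * r.+1)%:R^-1.
have w0 c : 0 < w c by rewrite invr_gt0 ltr0n muln_gt0 expn_gt0.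
have geom n : \sum_(l < n) (2 ^ l.+1)%:R^-1 = 1 - (2 ^ n)%:R^-1 :> F.
  elim: n => [|n IH]; first by rewrite big_ord0 expn0 invr1 subrr.
  have n0 : (2 ^ n)%:R != 0 :> F by rewrite pnatr_eq0 expn_eq0.
  by rewrite big_ord_recr /= IH expnS natrM; field.
have sum_w : \sum_c w c = 1 - (2 ^ m.+1)%:R^-1.
  rewrite -geom -(pair_bigA _ (fun l i => w (l, i))) /=; apply: eq_bigr => l _.
  rewrite /w /= sumr_const card_ord natrM invfM -[LHS]mulr_natr mulfVK //.
  by rewrite pnatr_eq0.
have S1 : \sum_c w c <= 1 by rewrite sum_w lerBlDr lerDl invr_ge0.
have S0 : 0 < \sum_c w c.
  by rewrite (bigD1 (ord0, ord0)) //= ltr_pwDl // sumr_ge0 // => c _; apply: ltW.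
exists (fun c => w c / \sum_c w c); split.
  split=> [c|]; first by apply: divr_ge0; apply: ltW.
  by rewrite -mulr_suml mulfV // gt_eqF.
move=> c; rewrite ler_pdivlMr // -[leRHS]mulr1.
by apply: ler_wpM2l => //; apply: ltW; apply: w0.
Qed.

Section Hypergraph.
Variables (k : nat) (V : finType) (H : hypergraph k V).

Definition coadjacent : rel V := fun u v =>
  (u != v) && [exists h in edges H, (u \in h) && (v \in h)].

Lemma coadjacent_sym : symmetric coadjacent.
Proof.
move=> u v; rewrite /coadjacent eq_sym; congr (_ && _).
by apply: eq_existsb => h; rewrite [(u \in h) && _]andbC.
Qed.

(** In the skeleton induced on [S], distinct neighbours [u] of [v] give distinct edges [[set v; u]],
    so edge degrees bound the numbers of neighbours. *)
Lemma coadjacent_degree (S : {set V}) : S != set0 ->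
  exists2 v, v \in S &
    (#|[set u in S | coadjacent v u]| <= skeletal_degeneracy H)%N.
Proof.
move=> S0; rewrite /skeletal_degeneracy /degeneracy; case: ex_minnP => d dg _.
pose G := [set f in skeleton H | f \subset S].
have sG : subgraph S G (skeleton H).
  by rewrite /subgraph S0 /=; apply/andP; split; apply/subsetP=> f;
    rewrite !inE => /andP[].
have /forallP/(_ S)/forallP/(_ G)/implyP/(_ sG)/existsP[v /andP[vS dv]] := dg.
exists v => //; apply: leq_trans dv.
rewrite -(card_in_imset (f := fun u => [set v; u])).
  apply: subset_leq_card; apply/subsetP=> f /imsetP[u]; rewrite inE.
  move=> /andP[uS vu] ->; rewrite !inE eqxx andbT; apply/andP; split.
    by apply/imset2P; exists v u; rewrite // inE.
  by apply/subsetP=> x; rewrite !inE => /orP[] /eqP ->.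
move=> u u'; rewrite !inE => /andP[_ /andP[vu _]] _ e.
have : u \in [set v; u'] by rewrite -e !inE eqxx orbT.
by rewrite !inE => /orP[/eqP uv|/eqP //]; rewrite uv eqxx in vu.
Qed.

End Hypergraph.

(** Classical, because the Ramsey property is stated in [Prop] without a decision procedure. *)
Lemma least_nat (P : nat -> Prop) N : P N ->
  exists2 r, P r & forall m, P m -> (r <= m)%N.
Proof.
have [n] := ubnP N; elim: n N => // n IH N Nn PN.
have [[m [mN Pm]]|h] := classic (exists m, (m < N)%N /\ P m).
  by apply: (IH m) => //; apply: leq_trans mN _.
exists N => // m Pm; rewrite leqNgt; apply/negP=> mN; apply: h; by exists m.
Qed.

Section Ramsey.
Variables (k q d : nat).
Hypothesis k_gt0 : (0 < k)%N.
Hypothesis q_gt0 : (0 < q)%N.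

(** The degree bound of [degenerate_levels]; the successor makes it positive when [d = 0]. *)
Let D := (8 * d).+1.

Lemma linear_ramsey_property : exists C : nat, (0 < C)%N /\
  forall (V : finType) (H : hypergraph k V), (0 < #|V|)%N ->
    skeletal_degeneracy H = d -> ramsey_property q H (C * #|V|).
Proof.
have [M0 [rho [rho0 clq]]] := random_monochromatic_clique rat k q ('I_d.+1 * 'I_(2 * D))%type.
pose K : rat := moment_bound D rho.
have K0 : 0 <= K.
  rewrite /K /moment_bound divr_ge0 ?(ltW rho0) // mulr_ge0 ?exprn_ge0 // addr_ge0 //.
  by rewrite exprn_ge0 // !mulr_ge0.
pose b : rat := (4 * d.+1 * D.+1)%:R * K.
(* The first summand gives the clique lemma enough vertices, and exceeding [b] makes the expected
   loss less than 1. The factor [4 * d.+1] in [b] comes from inverse label probabilities, at most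
   [2 ^ (lev x).+1 * d.+1], with [2 ^ lev x] summing to at most [2 * #|V|]. *)
exists (2 * M0 ^ 2 + Num.bound b).+1; split=> // V H V0 Hd.
set C := _.+1; set N := (C * #|V|)%N => c.
have N_gt0 : (0 < N)%N by rewrite muln_gt0.
have RN : #|'I_N| = N := card_ord N.
(* The colouring is extended to all sets; the value off the [k]-sets is arbitrary. *)
pose col (A : {set 'I_N}) : 'I_q :=
  if insub A : option {e : {set 'I_N} | #|e| == k} is Some e then c e
  else Ordinal q_gt0.
pose e := coadjacent H; have e_sym : symmetric e := @coadjacent_sym k V H.
have e_irr : irreflexive e by move=> u; rewrite /e /coadjacent eqxx.
have e_deg (S : {set V}) : S != set0 ->
    exists2 v, v \in S & (#|[set u in S | e v u]| <= d)%N.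
  by rewrite -Hd; apply: coadjacent_degree.
have e_edge h x y : h \in edges H -> x \in h -> y \in h -> x != y -> e x y.
  by move=> hE xh yh xy; rewrite /e /coadjacent xy; apply/exists_inP; exists h; rewrite ?xh.
have [tau tauP] := degenerate_coloring e_sym e_deg e_irr.
have [lev [levP lev_sum]] := degenerate_levels e_sym e_deg.
pose m := \max_x lev x; have lev_m x : (lev x <= m)%N by apply: leq_bigmax.
have [p [dp p_ge]] := geometric_label_distr rat m d.
pose cl x : 'I_m.+1 * 'I_d.+1 := (inord (lev x), tau x).
(* Higher levels come first, and types break ties within a level. Earlier neighbours thus have at
   least the level of [x], where [levP] counts them, and the remainder modulo [d.+1] recovers the
   type. *)
pose ord x := ((m - lev x) * d.+1 + tau x)%N.
have tau_inj h : h \in edges H -> {in h &, injective tau}.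
  move=> hE x y xh yh txy; apply: contraTeq isT => xy.
  by have := tauP x y (e_edge h x y hE xh yh xy); rewrite txy eqxx.
have ord_inj h : h \in edges H -> {in h &, injective ord}.
  move=> hE x y xh yh /(congr1 (modn^~ d.+1)); rewrite !modnMDl !modn_small //.
  by move=> txy; apply: (tau_inj h hE x y xh yh); apply: val_inj.
have cl_ord x y : cl x = cl y -> ord x = ord y.
  case=> /(congr1 val); rewrite /= !inordK ?ltnS // => lxy txy.
  by rewrite /ord lxy txy.
have earlier_card x : (#|earlier (edges H) ord x| <= D)%N.
  apply: leq_trans (leqW (levP x)); apply: subset_leq_card; apply/subsetP=> y.
  rewrite !inE => /andP[yx /exists_inP[h hE /andP[xh yh]]].
  apply/andP; split.
    by apply: e_edge hE xh yh _; apply: contraTneq yx => ->; rewrite ltnn.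
  rewrite leqNgt; apply: contraL yx => lt; rewrite -leqNgt /ord.
  have := ltn_ord (tau x); have := lev_m x; have := lev_m y.
  have : ((m - lev x).+1 * d.+1 <= (m - lev y) * d.+1)%N.
    by rewrite leq_pmul2r //; have := lev_m x; lia.
  rewrite mulSn; lia.
have p_gt0 x : 0 < p (cl x).
  by apply: lt_le_trans (p_ge _); rewrite invr_gt0 ltr0n muln_gt0 expn_gt0.
have [|chi [iota [iota_inj chi_prob]]] := clq 'I_N col.
  rewrite RN /N /C; apply: (@leq_trans (2 * M0 ^ 2 + Num.bound b).+1).
    by rewrite ltnS leq_addr.
  by rewrite leq_pmulr.
have R_gt0 : (0 < #|'I_N|)%N by rewrite RN.
have small : \sum_x D.+1%:R * K / (#|'I_N|%:R * p (cl x)) < 1.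
  have N0 : 0 < N%:R :> rat by rewrite ltr0n.
  have D0 : 0 <= D.+1%:R * K / N%:R by rewrite divr_ge0 // mulr_ge0.
  apply: (@le_lt_trans _ _ (\sum_x D.+1%:R * K / N%:R * (2 ^ (lev x).+1 * d.+1)%:R)).
    apply: ler_sum => x _; rewrite RN invfM mulrA; apply: ler_wpM2l => //.
    rewrite -[leRHS]invrK lef_pV2 ?posrE ?p_gt0 //.
      by have := p_ge (cl x); rewrite /= inordK // ltnS.
    by rewrite invr_gt0 ltr0n muln_gt0 expn_gt0.
  rewrite -mulr_sumr -natr_sum.
  have le4 : (\sum_x 2 ^ (lev x).+1 * d.+1 <= 4 * d.+1 * #|V|)%N.
    rewrite -big_distrl /= (eq_bigr (fun x => 2 * 2 ^ lev x)%N) => [|x _]; last exact: expnS.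
    rewrite -big_distrr /=; apply: leq_trans (leq_mul (leq_mul (leqnn 2) lev_sum) (leqnn _)) _.
    by rewrite !mulnA mulnAC.
  apply: (@le_lt_trans _ _ (D.+1%:R * K / N%:R * (4 * d.+1 * #|V|)%:R)).
    by rewrite ler_wpM2l // ler_nat.
  have -> : D.+1%:R * K / N%:R * (4 * d.+1 * #|V|)%:R = b * #|V|%:R / N%:R.
    by rewrite /b !natrM; field; rewrite !pnatr_eq0 -!lt0n V0.
  rewrite ltr_pdivrMr // mul1r /N natrM ltr_pM2r ?ltr0n //.
  have b0 : 0 <= b by rewrite mulr_ge0.
  apply: lt_le_trans (archi_boundP b0) _.
  by rewrite ler_nat /C; lia.
have [phi [phi_inj phi_col]] := random_clique_embedding iota_inj tau_inj ord_inj
  R_gt0 (ltn0Sn (8 * d)) erefl dp p_gt0 cl_ord earlier_card rho0 chi_prob k_gt0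
  (@edges_uniform k V H) small.
exists phi, chi; split=> // h f hE fE.
rewrite -(phi_col h hE) -fE /col.
by rewrite (valK (f : {e : {set 'I_N} | #|e| == k})).
Qed.

End Ramsey.

Local Close Scope ring_scope.

Theorem theorem1p5 (k q d : nat) (hk : 0 < k) (hq : 0 < q) :
  exists C : nat,
    forall (n : nat) (V : finType) (H : hypergraph k V),
      0 < n -> #|V| = n -> skeletal_degeneracy H = d ->
      exists r : nat, is_ramsey_number q H r /\ r <= C * n.
Proof.
have [C [C0 HC]] := linear_ramsey_property d hk hq.
exists C => n V H n0 Vn Hd.
have V0 : 0 < #|V| by rewrite Vn.
have CP : 0 < C * n /\ ramsey_property q H (C * n).
  by rewrite muln_gt0 C0 n0 -Vn; split=> //; apply: HC.
have [r [r0 rP] rmin] := least_nat (P := fun N => 0 < N /\ ramsey_property q H N) CP.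
by exists r; split; [split=> // N N0 NP; apply: rmin | apply: rmin].
Qed.
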